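(* Let $\mathcal{B}(\Omega)$ be an $\ell^2$-valued Bergman-type space, and let $\kappa\in[0,2)$ be the constant from property (A.6). Let $T$ be a linear operator with values in $\mathcal{B}(\Omega)$, defined a priori only on the linear span of the normalized reproducing kernels, i.e. on the set of finite sums $\sum_m k_{z_m}h_m$ with $z_m\in\Omega$ and $h_m\in\ell^2$ finite. Assume that there exists a linear operator $T^*$, defined on the same span and with values in $\mathcal{B}(\Omega)$, such that $\langle T(k_ze),k_wh\rangle_{\mathcal{B}(\Omega)}=\langle k_ze,T^*(k_wh)\rangle_{\mathcal{B}(\Omega)}$ for all $z,w\in\Omega$ and all finite $e,h\in\ell^2$. If for some $p$ with $\frac{4-\kappa}{2-\kappa}<p<\infty$ $$\sup_{i\in\mathbb{N}}\sup_{z\in\Omega}\left\{\int_{\Omega}\left(\sum_{k=1}^{\infty}\left|\left\langle U_zT^*(k_ze_i)(u),e_k\right\rangle_{\ell^2}\right|\right)^{p}d\sigma(u)\right\}^{1/p}<\infty$$ and $$\sup_{k\in\mathbb{N}}\sup_{z\in\Omega}\left\{\int_{\Omega}\left(\sum_{i=1}^{\infty}\left|\left\langle U_zT(k_ze_k)(u),e_i\right\rangle_{\ell^2}\right|\right)^{p}d\sigma(u)\right\}^{1/p}<\infty,$$ then $T$ can be extended to a bounded operator on $\mathcal{B}(\Omega)$.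
   Context: Notation: $\{e_k\}_{k\ge1}$ is the standard orthonormal basis of $\ell^2$; a vector $e\in\ell^2$ is finite if only finitely many coordinates $\langle e,e_k\rangle$ are nonzero. A function $f:\Omega\to\ell^2$ is measurable (analytic) if every $\langle f(\cdot),e_k\rangle_{\ell^2}$ is. $L^2(\Omega,\ell^2;d\sigma)$ has inner product $\int_\Omega\langle f,g\rangle_{\ell^2}d\sigma$. $A\lesssim B$ means $A\le CB$ for a constant $C$; $A\simeq B$ means $A\lesssim B$ and $B\lesssim A$. An $\ell^2$-valued Bergman-type space $\mathcal{B}(\Omega)$ is given by the following data and assumptions. (A.1) $\Omega\subset\mathbb{C}^n$ is a connected open set containing $0$; for each $z\in\Omega$ there is an involution $\varphi_z\in\mathrm{Aut}(\Omega)$ (biholomorphic, $\varphi_z\circ\varphi_z=\mathrm{id}$) with $\varphi_z(0)=z$. (A.2) $\mathfrak{d}$ is a metric on $\Omega$ with $\mathfrak{d}(u,v)\simeq\mathfrak{d}(\varphi_z(u),\varphi_z(v))$, constants independent of $z,u,v$; $(\Omega,\mathfrak{d})$ is separable and its closed balls are compact. $D(z,r)$ is the $\mathfrak{d}$-ball of center $z$ and radius $r$. (A.3) $\sigma$ is a finite Borel measure on $\Omega$. $\mathcal{B}(\Omega)$ is the space of analytic $f:\Omega\to\ell^2$ in $L^2(\Omega,\ell^2;d\sigma)$, and $\mathcal{B}(\Omega,\mathbb{C})$ the space of scalar analytic functions in $L^2(\Omega,\mathbb{C};d\sigma)$, with the inherited norms and inner products. They are reproducing kernel Hilbert spaces: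 there are $K_z\in\mathcal{B}(\Omega,\mathbb{C})$ with $f(z)=\int_\Omega\overline{K_z(w)}f(w)\,d\sigma(w)$ for all $z\in\Omega$ and all $f$ in $\mathcal{B}(\Omega,\mathbb{C})$ or in $\mathcal{B}(\Omega)$ (coordinatewise integral). $k_z:=K_z/\|K_z\|_{\mathcal{B}(\Omega,\mathbb{C})}$, and $z\mapsto\|K_z\|_{\mathcal{B}(\Omega,\mathbb{C})}$ is continuous on $(\Omega,\mathfrak{d})$. (A.4) $d\lambda(z):=\|K_z\|^2_{\mathcal{B}(\Omega,\mathbb{C})}d\sigma(z)$ satisfies $\lambda(E)\simeq\lambda(\varphi_z(E))$ for Borel $E$, constants independent of $z$ (and $E$), and is doubling: $\lambda(D(z,2r))\le C\lambda(D(z,r))$ for all $z\in\Omega$, $r>0$, for some $C>1$. (A.5) $|\langle k_z,k_w\rangle_{\mathcal{B}(\Omega,\mathbb{C})}|\simeq 1/\|K_{\varphi_z(w)}\|_{\mathcal{B}(\Omega,\mathbb{C})}$, constants independent of $z,w$. (A.6) Either there is $0<\kappa<2$ such that $$\int_\Omega\frac{|\langle K_z,K_w\rangle|^{(r+s)/2}}{\|K_z\|^s\|K_w\|^r}\,d\lambda(w)\le C(r,s)<\infty\quad\text{for all }z\in\Omega$$ (norms and inner products in $\mathcal{B}(\Omega,\mathbb{C})$) for all $r>\kappa>s>0$; or this holds for all $r=s>0$, in which case one sets $\kappa=0$. (A.7) $\|K_z\|_{\mathcal{B}(\Omega,\mathbb{C})}\to\infty$ as $\mathfrak{d}(z,0)\to\infty$.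 For $e\in\ell^2$, $k_ze$ denotes the function $w\mapsto k_z(w)e$. For $z\in\Omega$, the translation operator $U_z$ on $\mathcal{B}(\Omega)$ is $U_zf(w)=f(\varphi_z(w))k_z(w)$. *)

(* Defs.v *)
From HB Require Import structures.
From mathcomp Require Import all_boot all_order all_algebra.
From mathcomp.real_closed Require Export complex.
From mathcomp Require Import all_classical all_reals all_analysis.

Set Implicit Arguments.
Unset Strict Implicit.
Unset Printing Implicit Defensive.

Import Order.TTheory GRing.Theory Num.Theory.
Import numFieldNormedType.Exports.

Local Open Scope classical_set_scope.
Local Open Scope ring_scope.
Local Open Scope complex_scope.

(* The complex numbers are R[i], for any [R : realType]; they carry their
   topology as the regular module R[i]^o. *)

Record domain (R : realType) (n : nat) := Domain {
  domain_set :> set 'rV[R[i]^o]_n ;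
  domain_open : open domain_set ;
  domain_connected : connected domain_set ;
  domain_contains0 : domain_set 0
}.

(* The points of a domain, with the subspace topology and the Borel
   sigma-algebra; the distinguished point is the origin of C^n. *)
Definition pt (R : realType) (n : nat) (D : domain R n) : Type := set_type D.

Section pt_instances.
Context (R : realType) (n : nat) (D : domain R n).

Definition origin : pt D := exist _ 0 (mem_set (domain_contains0 D)).

HB.instance Definition _ := Topological.copy (pt D) (set_type D).
HB.instance Definition _ := isPointed.Build (pt D) origin.
HB.instance Definition _ :=
  Measurable.copy (pt D) (g_sigma_algebraType (@open (pt D))).

End pt_instances.

Record metric_on (R : realType) (X : Type) := MetricOn {
  metric_dist :> X -> X -> R ;
  metric_distxx : forall x, metric_dist x x = 0 ;
  metric_dist_eq0 : forall x y, metric_dist x y = 0 -> x = y ;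
  metric_distC : forall x y, metric_dist x y = metric_dist y x ;
  metric_dist_triangle : forall y x z,
    metric_dist x z <= metric_dist x y + metric_dist y z
}.

(* The set X with the topology of the metric d.  On [pt D] this topology is
   not assumed to be the Euclidean one. *)
Definition metric_space (R : realType) (X : Type) (d : metric_on R X) : Type :=
  X.

Section metric_space_instance.
Context (R : realType) (X : choiceType) (d : metric_on R X).

HB.instance Definition _ := Choice.copy (metric_space d) X.
HB.instance Definition _ := @isMetric.Build R (metric_space d) d
  (metric_distxx d) (@metric_dist_eq0 _ _ d) (metric_distC d)
  (@metric_dist_triangle _ _ d).

End metric_space_instance.

(* A vector of l^2 is given by its sequence of coordinates, numbered from 0:
   the k-th basis vector is e_(k+1) in the usual numbering. *)
Section l2.
Context {R : realType}.
Implicit Types x y : nat -> R[i].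

Definition l2sqnorm x : \bar R := (\sum_(k <oo) (Normc.normc (x k) ^+ 2)%:E)%E.

Definition in_l2 x : Prop := (l2sqnorm x < +oo)%E.

Definition l2dot x y : R[i] :=
  limn (series (fun k => x k * (y k)^* : R[i]^o)).

Definition l2basis (k : nat) : nat -> R[i] := fun j => (j == k)%:R.

Definition finite_vector x : Prop := finite_set [set k | x k != 0].

End l2.

Definition complex_integral (R : realType) (d : measure_display)
    (X : measurableType d) (mu : {measure set X -> \bar R}) (f : X -> R[i]) :
    R[i] :=
  Complex (\int[mu]_x complex.Re (f x)) (\int[mu]_x complex.Im (f x)).

(* Holomorphic: the extension of f by 0 outside D is complex
   Frechet-differentiable at every point of the open set D. *)
Definition analytic (R : realType) (n : nat) (D : domain R n)
    (V : normedModType R[i]) (f : pt D -> V) : Prop :=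
  forall z : 'rV[R[i]^o]_n, domain_set D z -> differentiable ('valL_ 0 f) z.

Definition automorphism (R : realType) (n : nat) (D : domain R n)
    (f : pt D -> pt D) : Prop :=
  exists g : pt D -> pt D, [/\ cancel f g, cancel g f,
    analytic (fun z => set_val (f z)) & analytic (fun z => set_val (g z))].

Definition complete_for (R : realType) (V : zmodType) (A : set V)
    (N : V -> R) : Prop :=
  forall u : nat -> V, (forall i, A (u i)) ->
    (forall e, 0 < e -> exists M : nat, forall i j,
      (M <= i)%N -> (M <= j)%N -> N (u i - u j) < e) ->
  exists2 f, A f & N (u i - f) @[i --> \oo] --> (0 : R).

Section spaces.
Context {R : realType} {n : nat} {D : domain R n}.
Variable sigma : {finite_measure set (pt D) -> \bar R}.
Implicit Types (f g : pt D -> R[i]) (F G : pt D -> nat -> R[i]).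

Definition scalar_bergman : set (pt D -> R[i]) := [set f |
  analytic (f : pt D -> R[i]^o) /\
  (\int[sigma]_w (Normc.normc (f w) ^+ 2)%:E < +oo)%E].

Definition scalar_dot f g : R[i] :=
  complex_integral sigma (fun w => f w * (g w)^*).

Definition scalar_norm f : R := Num.sqrt (complex.Re (scalar_dot f f)).

Definition bergman : set (pt D -> nat -> R[i]) := [set F |
  [/\ forall w, in_l2 (F w),
      forall k, analytic (fun w => F w k : R[i]^o) &
      (\int[sigma]_w l2sqnorm (F w) < +oo)%E]].

Definition bergman_dot F G : R[i] :=
  complex_integral sigma (fun w => l2dot (F w) (G w)).

Definition bergman_norm F : R := Num.sqrt (complex.Re (bergman_dot F F)).

(* lambda, i.e. d lambda(z) = |K_z|^2 d sigma(z), as a function of sets *)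
Definition lambda_of (K : pt D -> pt D -> R[i]) (E : set (pt D)) : \bar R :=
  (\int[sigma]_(z in E) (scalar_norm (K z) ^+ 2)%:E)%E.

(* The integral condition with exponents r and s; the last factor |K_w|^2
   turns d sigma(w) into d lambda(w). *)
Definition kernel_estimate (K : pt D -> pt D -> R[i]) (r s : R) : Prop :=
  exists C : R, forall z,
    (\int[sigma]_w
       (Normc.normc (scalar_dot (K z) (K w)) `^ ((r + s) / 2)
          / (scalar_norm (K z) `^ s * scalar_norm (K w) `^ r)
        * scalar_norm (K w) ^+ 2)%:E <= C%:E)%E.

Definition normalized_kernel (K : pt D -> pt D -> R[i]) (z w : pt D) : R[i] :=
  K z w / (scalar_norm (K z))%:C.

End spaces.

(* Each equivalence A ~ B is stated with one positive constant serving in both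
   directions. *)
Record bergman_space (R : realType) (n : nat) := BergmanSpace {
  dom :> domain R n ;
  phi : pt dom -> pt dom -> pt dom ;
  phi_aut : forall z, automorphism (phi z) ;
  phi_involution : forall z, involutive (phi z) ;
  phi_origin : forall z, phi z (origin dom) = z ;

  dist : metric_on R (pt dom) ;
  dist_quasi_invariant : exists2 C : R, 0 < C & forall z u v,
    dist u v <= C * dist (phi z u) (phi z v) /\
    dist (phi z u) (phi z v) <= C * dist u v ;
  dist_separable : exists2 S : set (metric_space dist), countable S & dense S ;
  dist_compact_balls : forall (z : pt dom) (r : R),
    compact ([set u | dist z u <= r] : set (metric_space dist)) ;

  sigma : {finite_measure set (pt dom) -> \bar R} ;
  K : pt dom -> pt dom -> R[i] ;
  scalar_complete : complete_for (scalar_bergman sigma) (scalar_norm sigma) ;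
  bergman_complete : complete_for (bergman sigma) (bergman_norm sigma) ;
  K_bergman : forall z, scalar_bergman sigma (K z) ;
  K_scalar_reproducing : forall f z, scalar_bergman sigma f ->
    f z = complex_integral sigma (fun w => (K z w)^* * f w) ;
  K_reproducing : forall F z k, bergman sigma F ->
    F z k = complex_integral sigma (fun w => (K z w)^* * F w k) ;
  K_norm_continuous :
    continuous (fun z : metric_space dist => scalar_norm sigma (K z)) ;

  lambda_quasi_invariant : exists2 C : R, 0 < C & forall z E, measurable E ->
    (lambda_of sigma K E <= C%:E * lambda_of sigma K (phi z @` E))%E /\
    (lambda_of sigma K (phi z @` E) <= C%:E * lambda_of sigma K E)%E ;
  (* implicit in the use of lambda(D(z, r)) *)
  dist_ball_measurable : forall (z : pt dom) (r : R),
    measurable [set u | dist z u < r] ;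
  lambda_doubling : exists2 C : R, 1 < C &
    forall (z : pt dom) (r : R), 0 < r ->
    (lambda_of sigma K [set u | dist z u < 2 * r]%R
      <= C%:E * lambda_of sigma K [set u | dist z u < r]%R)%E ;

  normalized_kernel_dot : exists2 C : R, 0 < C & forall z w,
    let a := Normc.normc (scalar_dot sigma
      (normalized_kernel sigma K z) (normalized_kernel sigma K w)) in
    let b := 1 / scalar_norm sigma (K (phi z w)) in
    a <= C * b /\ b <= C * a ;

  kappa : R ;
  kappa_estimate :
    (0 < kappa < 2 /\ forall r s, kappa < r -> 0 < s < kappa ->
       kernel_estimate sigma K r s) \/
    (kappa = 0 /\ forall r, 0 < r -> kernel_estimate sigma K r r) ;

  K_norm_unbounded : forall M : R, exists r : R, forall z,
    r < dist z (origin dom) -> M < scalar_norm sigma (K z)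
}.

Arguments phi {R n} b z w.
Arguments K {R n} b z w.
Arguments kappa {R n} b.

Section operators.
Context {R : realType} {n : nat} (B : bergman_space R n).
Local Notation fun_space := (pt B -> nat -> R[i]).

Definition kernel_vector (z : pt B) (e : nat -> R[i]) : fun_space :=
  fun w k => normalized_kernel (sigma B) (K B) z w * e k.

Definition kernel_span : set fun_space := [set F |
  exists (m : nat) (z : 'I_m -> pt B) (h : 'I_m -> nat -> R[i]),
    (forall i, finite_vector (h i)) /\
    F = fun w k => \sum_(i < m) kernel_vector (z i) (h i) w k].

Definition translation (z : pt B) (F : fun_space) : fun_space :=
  fun w k => F (phi B z w) k * normalized_kernel (sigma B) (K B) z w.

(* T is a linear operator with domain the subspace A and values in A'; its
   values outside A are irrelevant. *)
Definition linear_operator (A A' : set fun_space) (T : fun_space -> fun_space) :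
    Prop :=
  (forall F, A F -> A' (T F)) /\
  (forall (a : R[i]) F G, A F -> A G ->
     T (fun w k => a * F w k + G w k) = fun w k => a * T F w k + T G w k).

Definition bounded_operator (S : fun_space -> fun_space) : Prop :=
  linear_operator (bergman (sigma B)) (bergman (sigma B)) S /\
  exists C : R, forall F, bergman (sigma B) F ->
    bergman_norm (sigma B) (S F) <= C * bergman_norm (sigma B) F.

End operators.

Arguments kernel_span {R n} B _.

(* Main.v *)
Require Import Defs.
From mathcomp Require Import all_boot all_order all_algebra.
From mathcomp Require Import all_classical all_reals all_analysis.
From mathcomp Require Import measurable_realfun.
From mathcomp Require Import ring lra.

(** Write N_z for the norm of the kernel K_z, k_z = K_z / N_z, and M for N at
    phi_z(w).  For F in the span of the kernels, the reproducing property and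
    the adjoint relation give

      (T F)_i(z) = sum_j int F_j(w) conj(N_z (Tstar (k_z e_i))_j(w)) dsigma(w),

    so T is an infinite matrix of integral operators with entries of modulus

      A_ij(z, w) = N_z |(Tstar (k_z e_i))_j(w)| = N_w |(T (k_w e_j))_i(z)|.

    The bound on the span is a Schur test for this matrix ([schur_test]) with
    the weight N^a.  By the symmetry of A, its row and column conditions are one
    and the same estimate ([weighted_l1_bound]), applied to Tstar and to T:

      N_z int (sum_j |F_j(w)|) N_w^a dsigma(w) <= C N_z^a,

    for F such that U_z F, measured by the l^1 norm of its values, is bounded in
    L^p uniformly in z.  To prove it, split the integrand by Young's inequality
    into a p-th power and a q-th power, 1/p + 1/q = 1.  Since |k_z(phi_z(w))|
    is comparable to M / N_w, the p-th power is the change of variables by phi_z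
    of |U_z F|^p, and lambda is quasi-invariant.  Since 1 / M is comparable to
    |<K_z, K_w>| / (N_z N_w), the q-th power is the integrand of the kernel
    estimate with exponents r = 2 - a q and s = a q - 2 q + 2.  An a with
    s < kappa < r and 0 < s exists exactly when p > (4 - kappa) / (2 - kappa)
    ([schur_exponent]); for kappa = 0 the choice a = 1 gives r = s > 0.

    Exchanging the integrals in the Schur test requires A to be jointly
    measurable: it is measurable in w and, by symmetry, continuous in z
    ([measurable_separately_continuous]).

    To extend T, the span has to be dense.  A minimizing sequence for the
    distance from a function to the span leaves, by completeness, a residue of
    least norm modulo the span ([orthogonal_residue]); varying it along k_z e_i
    shows that its i-th coordinate vanishes at z ([residue_zero]).  The
    extension by continuity is [bounded_extension]. *)

Set Implicit Arguments.
Unset Strict Implicit.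
Unset Printing Implicit Defensive.

Import Order.TTheory GRing.Theory Num.Theory.
Import numFieldNormedType.Exports.

Local Open Scope classical_set_scope.
Local Open Scope ring_scope.
Local Open Scope complex_scope.

Local Notation normc := Normc.normc.
Local Notation norm B z := (scalar_norm (Defs.sigma B) (Defs.K B z)).

(** * Complex numbers *)

Section complex_topology.
Context {R : realType}.
Local Notation C := (R[i]^o).

Lemma normcRe (z : R[i]) : `|z| = (normc z)%:C.
Proof. by case: z. Qed.

Lemma normc_ge0 (z : R[i]) : 0 <= normc z.
Proof. by case: z => a b; exact: sqrtr_ge0. Qed.

Lemma sqr_normc_ReIm (z : R[i]) :
  normc z ^+ 2 = complex.Re z ^+ 2 + complex.Im z ^+ 2.
Proof. by case: z => a b /=; rewrite sqr_sqrtr// addr_ge0// sqr_ge0. Qed.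

Lemma ler_normRe (z : R[i]) : `|complex.Re z| <= normc z.
Proof.
by rewrite -(ler_pXn2r (n:=2))// ?nnegrE ?normc_ge0// sqr_normc_ReIm real_normK
  ?num_real// lerDl sqr_ge0.
Qed.

Lemma ler_normIm (z : R[i]) : `|complex.Im z| <= normc z.
Proof.
by rewrite -(ler_pXn2r (n:=2))// ?nnegrE ?normc_ge0// sqr_normc_ReIm real_normK
  ?num_real// lerDr sqr_ge0.
Qed.

Lemma near_normc (z : C) (e : R) : 0 < e ->
  \forall w \near z, normc (z - w) < e.
Proof.
move=> e0; have eC : 0 < (e%:C : R[i]) by rewrite ltcR.
have : \forall w \near z, `|z - w| < e%:C.
  exact: (@cvgr_dist_lt _ _ _ (nbhs z) _ id z (@cvg_id _ _) _ eC).
by apply: (@filterS _ _ (nbhs_filter z)) => w; rewrite normcRe ltcR.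
Qed.

Lemma continuous_Re : continuous (@complex.Re R : C -> R).
Proof.
move=> z; apply/(@cvgrPdist_lt _ _ _ _ (nbhs_filter z)) => e /(near_normc z);
  apply: (@filterS _ _ (nbhs_filter z)) => w.
apply: le_lt_trans; have := ler_normRe (z - w).
by case: (z) => ? ?; case: (w).
Qed.

Lemma continuous_Im : continuous (@complex.Im R : C -> R).
Proof.
move=> z; apply/(@cvgrPdist_lt _ _ _ _ (nbhs_filter z)) => e /(near_normc z);
  apply: (@filterS _ _ (nbhs_filter z)) => w.
apply: le_lt_trans; have := ler_normIm (z - w).
by case: (z) => ? ?; case: (w).
Qed.

End complex_topology.

Section normc_lemmas.
Context {R : realType}.
Implicit Types a b : R[i].

(** For t = 1 this is the parallelogram law.  With a free t it survives
    integration, and optimizing t there gives the triangle inequality of the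
    integrated norm. *)
Lemma sqr_normcD_parallelogram (t : R) a b : 0 < t ->
  normc (a + b) ^+ 2 + t^-1 * normc (t%:C * a - b) ^+ 2 =
  (1 + t) * normc a ^+ 2 + (1 + t^-1) * normc b ^+ 2.
Proof.
move=> t0; rewrite !sqr_normc_ReIm; case: a => ? ?; case: b => ? ? /=.
by field; rewrite gt_eqF.
Qed.

Lemma normcJ a : normc a^* = normc a.
Proof. by case: a => ? ? /=; rewrite sqrrN. Qed.

Lemma sqr_normcDM a b c : normc (a + c * b) ^+ 2 =
  normc a ^+ 2 + 2 * complex.Re (c^* * (a * b^*)) + normc c ^+ 2 * normc b ^+ 2.
Proof.
by rewrite !sqr_normc_ReIm; case: a => ? ?; case: b => ? ?; case: c => ? ? /=; ring.
Qed.

(** Makes products of square-integrable functions integrable. *)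
Lemma normcM_le a b : normc (a * b) <= normc a ^+ 2 + normc b ^+ 2.
Proof.
rewrite Normc.normcM; have := normc_ge0 a; have := normc_ge0 b.
move: (normc a) (normc b) => x y ? ?; nra.
Qed.

Lemma mulcJ a : a * a^* = (normc a ^+ 2)%:C.
Proof.
by rewrite sqr_normc_ReIm; case: a => x y; simpc; congr Complex; ring.
Qed.

Lemma ler_dist_normc a b : `|normc a - normc b| <= normc (a - b).
Proof.
have h1 : normc a <= normc (a - b) + normc b.
  by rewrite -[X in normc X <= _](subrK b a); exact: le_normcD.
have h2 : normc b <= normc (a - b) + normc a.
  rewrite -(normcN (a - b)) opprB.
  by rewrite -[X in normc X <= _](subrK a b); exact: le_normcD.
by rewrite ler_norml; apply/andP; split; lra.
Qed.

Lemma normc_one : normc (1 : R[i]) = 1. Proof. exact: Normc.normc1. Qed.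

Lemma normc_zero : normc (0 : R[i]) = 0. Proof. exact: Normc.normc0. Qed.

End normc_lemmas.

(** * Integrals of complex functions *)

Section complex_integral_lemmas.
Context {R : realType} {d : measure_display} {X : measurableType d}.
Implicit Types f g : X -> R[i].

Definition cmeasurable f : Prop :=
  measurable_fun setT (@complex.Re R \o f) /\
  measurable_fun setT (@complex.Im R \o f).

Lemma cmeasurable_normc f : cmeasurable f ->
  measurable_fun setT (fun x => normc (f x)).
Proof.
move=> [mr mi].
rewrite (_ : (fun x => _) = (@Num.sqrt R) \o
  (fun x => complex.Re (f x) ^+ 2 + complex.Im (f x) ^+ 2)); last first.
  by apply/funext => x /=; case: (f x).
apply: measurableT_comp; first exact: continuous_measurable_fun (@sqrt_continuous R).
by apply: measurable_funD; apply: measurable_funX.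
Qed.

Lemma cmeasurable_cst c : cmeasurable (cst c).
Proof. by split; exact: measurable_cst. Qed.

Lemma cmeasurableD f g : cmeasurable f -> cmeasurable g ->
  cmeasurable (fun x => f x + g x).
Proof.
move=> [mf1 mf2] [mg1 mg2]; split.
  rewrite (_ : _ \o _ = (@complex.Re R \o f) \+ (@complex.Re R \o g)).
    exact: measurable_funD.
  by apply/funext => x /=; case: (f x) => ? ?; case: (g x).
rewrite (_ : _ \o _ = (@complex.Im R \o f) \+ (@complex.Im R \o g)).
  exact: measurable_funD.
by apply/funext => x /=; case: (f x) => ? ?; case: (g x).
Qed.

Lemma cmeasurableM f g : cmeasurable f -> cmeasurable g ->
  cmeasurable (fun x => f x * g x).
Proof.
move=> [mf1 mf2] [mg1 mg2]; split.
  rewrite (_ : _ \o _ = ((@complex.Re R \o f) \* (@complex.Re R \o g)) \-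
    ((@complex.Im R \o f) \* (@complex.Im R \o g))).
    by apply: measurable_funB; apply: measurable_funM.
  by apply/funext => x /=; case: (f x) => ? ?; case: (g x).
rewrite (_ : _ \o _ = ((@complex.Re R \o f) \* (@complex.Im R \o g)) \+
    ((@complex.Im R \o f) \* (@complex.Re R \o g))).
  by apply: measurable_funD; apply: measurable_funM.
by apply/funext => x /=; case: (f x) => ? ?; case: (g x).
Qed.

Lemma cmeasurableJ f : cmeasurable f -> cmeasurable (fun x => (f x)^*).
Proof.
move=> [mf1 mf2]; split.
  by rewrite (_ : _ \o _ = @complex.Re R \o f)//; apply/funext => x /=; case: (f x).
rewrite (_ : _ \o _ = \- (@complex.Im R \o f)); last first.
  by apply/funext => x /=; case: (f x).
exact: measurable_funN.
Qed.

Variable mu : {measure set X -> \bar R}.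

Definition cintegrable f : Prop :=
  cmeasurable f /\ (\int[mu]_x (normc (f x))%:E < +oo)%E.

Lemma cintegrable_Re f : cintegrable f ->
  mu.-integrable setT (EFin \o (@complex.Re R \o f)).
Proof.
move=> [[mr mi] fin]; apply/integrableP; split; first exact/measurable_EFinP.
apply: le_lt_trans fin; apply: ge0_le_integral => //.
- exact/measurableT_comp/measurable_EFinP.
- exact/measurable_EFinP/cmeasurable_normc.
- by move=> x _; rewrite lee_fin ler_normRe.
Qed.

Lemma cintegrable_Im f : cintegrable f ->
  mu.-integrable setT (EFin \o (@complex.Im R \o f)).
Proof.
move=> [[mr mi] fin]; apply/integrableP; split; first exact/measurable_EFinP.
apply: le_lt_trans fin; apply: ge0_le_integral => //.
- exact/measurableT_comp/measurable_EFinP.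
- exact/measurable_EFinP/cmeasurable_normc.
- by move=> x _; rewrite lee_fin ler_normIm.
Qed.

Lemma cintegrableD f g : cintegrable f -> cintegrable g ->
  cintegrable (fun x => f x + g x).
Proof.
move=> [mf If] [mg Ig]; split; first exact: cmeasurableD.
have mnf : measurable_fun setT (fun x => (normc (f x))%:E).
  exact/measurable_EFinP/cmeasurable_normc.
have mng : measurable_fun setT (fun x => (normc (g x))%:E).
  exact/measurable_EFinP/cmeasurable_normc.
apply: (@le_lt_trans _ _ (\int[mu]_x ((normc (f x))%:E + (normc (g x))%:E))%E).
  apply: ge0_le_integral => //.
  - by move=> x _; rewrite lee_fin normc_ge0.
  - by apply/measurable_EFinP/cmeasurable_normc/cmeasurableD.
  - exact: emeasurable_funD.
  - by move=> x _; rewrite -EFinD lee_fin le_normcD.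
rewrite ge0_integralD//; first exact: lte_add_pinfty.
all: by move=> x _; rewrite lee_fin normc_ge0.
Qed.

Lemma cintegrableZ c f : cintegrable f -> cintegrable (fun x => c * f x).
Proof.
move=> [mf If]; split; first exact: (cmeasurableM (cmeasurable_cst c)).
under eq_integral do rewrite Normc.normcM EFinM.
rewrite ge0_integralZl_EFin//.
- by rewrite lte_mul_pinfty// lee_fin normc_ge0.
- by move=> x _; rewrite lee_fin normc_ge0.
- exact/measurable_EFinP/cmeasurable_normc.
- exact: normc_ge0.
Qed.

Lemma cintegrable_mul f g : cmeasurable f -> cmeasurable g ->
  (\int[mu]_x (normc (f x) ^+ 2)%:E < +oo)%E ->
  (\int[mu]_x (normc (g x) ^+ 2)%:E < +oo)%E ->
  cintegrable (fun x => f x * g x).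
Proof.
move=> mf mg If Ig; split; first exact: cmeasurableM.
have mnf : measurable_fun setT (fun x => (normc (f x) ^+ 2)%:E).
  exact/measurable_EFinP/measurable_funX/cmeasurable_normc.
have mng : measurable_fun setT (fun x => (normc (g x) ^+ 2)%:E).
  exact/measurable_EFinP/measurable_funX/cmeasurable_normc.
apply: (@le_lt_trans _ _ (\int[mu]_x ((normc (f x) ^+ 2)%:E + (normc (g x) ^+ 2)%:E))%E).
  apply: ge0_le_integral => //.
  - by move=> x _; rewrite lee_fin normc_ge0.
  - by apply/measurable_EFinP/cmeasurable_normc/cmeasurableM.
  - exact: emeasurable_funD.
  - by move=> x _; rewrite -EFinD lee_fin normcM_le.
rewrite ge0_integralD//; first exact: lte_add_pinfty.
all: by move=> x _; rewrite lee_fin sqr_ge0.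
Qed.

Lemma complex_integralD f g : cintegrable f -> cintegrable g ->
  complex_integral mu (fun x => f x + g x) =
  complex_integral mu f + complex_integral mu g.
Proof.
move=> If Ig; rewrite /complex_integral; simpc; congr Complex.
  rewrite -RintegralD//; [|exact: cintegrable_Re..].
  by apply: eq_Rintegral => x _; case: (f x) => ? ?; case: (g x).
rewrite -RintegralD//; [|exact: cintegrable_Im..].
by apply: eq_Rintegral => x _; case: (f x) => ? ?; case: (g x).
Qed.

Lemma complex_integralZ c f : cintegrable f ->
  complex_integral mu (fun x => c * f x) = c * complex_integral mu f.
Proof.
move=> If; rewrite /complex_integral; case: c => a b; simpc.
have Ir := cintegrable_Re If; have Ii := cintegrable_Im If.
have IZ (r : R) (g : X -> R) : mu.-integrable setT (EFin \o g) ->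
    mu.-integrable setT (EFin \o (fun x => r * g x)).
  move=> Ig; rewrite (_ : _ \o _ = fun x => r%:E * (EFin \o g) x)%E.
    exact: integrableZl.
  by apply/funext => x /=; rewrite EFinM.
rewrite -!RintegralZl// -RintegralB//; [|exact: (IZ _ _ Ir)|exact: (IZ _ _ Ii)].
rewrite -RintegralD//; [|exact: (IZ _ _ Ii)|exact: (IZ _ _ Ir)].
by congr Complex; apply: eq_Rintegral => x _; case: (f x).
Qed.

Lemma complex_integral0 : complex_integral mu (fun=> 0) = 0.
Proof. by rewrite /complex_integral !Rintegral_cst//= !mul0r. Qed.

(** The real and the imaginary part are estimated separately, hence the
    factor 2; it only enters the norm of the extended operator. *)
Lemma complex_integral_norm_le f : cintegrable f ->
  ((normc (complex_integral mu f))%:E <= 2%:E * \int[mu]_x (normc (f x))%:E)%E.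
Proof.
move=> If; have Ir := cintegrable_Re If; have Ii := cintegrable_Im If.
case: If => mf fin.
have finE : (\int[mu]_x (normc (f x))%:E)%E = (\int[mu]_x (normc (f x)))%:E.
  by rewrite /Rintegral fineK// ge0_fin_numE// integral_ge0// => x _;
    rewrite lee_fin normc_ge0.
have In : mu.-integrable setT (EFin \o (fun x => normc (f x))).
  apply/integrableP; split; first exact/measurable_EFinP/cmeasurable_normc.
  by under eq_integral do rewrite /= ger0_norm ?normc_ge0//.
rewrite finE -EFinM lee_fin /complex_integral.
apply: (@le_trans _ _ (`|\int[mu]_x complex.Re (f x)| + `|\int[mu]_x complex.Im (f x)|)).
  move: (Rintegral _ _ _) (Rintegral _ _ _) => a b /=.
  rewrite -(ler_pXn2r (n:=2))// ?nnegrE ?sqrtr_ge0 ?addr_ge0//.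
  rewrite sqr_sqrtr ?addr_ge0 ?sqr_ge0// -(real_normK (num_real a))
    -(real_normK (num_real b)).
  have := normr_ge0 a; have := normr_ge0 b; nra.
rewrite mulr_natl mulr2n lerD//.
  apply: le_trans (le_normr_Rintegral _ Ir) _ => //.
  apply: le_Rintegral => //; last by move=> x _; exact: ler_normRe.
  exact: integrable_norm.
apply: le_trans (le_normr_Rintegral _ Ii) _ => //.
apply: le_Rintegral => //; last by move=> x _; exact: ler_normIm.
exact: integrable_norm.
Qed.

End complex_integral_lemmas.

Section complex_integral_conj.
Context {R : realType} {d : measure_display} {X : measurableType d}.
Variable mu : {measure set X -> \bar R}.

Lemma conjc_divr (x : R[i]) (r : R) : ((x / r%:C)^* = x^* / r%:C)%R.
Proof.
change (conjc (x / r%:C) = conjc x / r%:C).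
rewrite -fmorphV; case: x => a b; simpc; congr Complex; ring.
Qed.

Lemma conjc_mull (r : R) (x : R[i]) : ((r%:C * x)^* = r%:C * x^*)%R.
Proof.
change (conjc (r%:C * x) = r%:C * conjc x).
by case: x => a b; simpc; congr Complex; ring.
Qed.

Lemma complex_integralJ (f : X -> R[i]) : cintegrable mu f ->
  complex_integral mu (fun x => (f x)^*) = (complex_integral mu f)^*.
Proof.
move=> If; rewrite /complex_integral /=; congr Complex.
  by apply: eq_Rintegral => x _; case: (f x).
rewrite -mulN1r -RintegralZl//; last exact: cintegrable_Im.
by apply: eq_Rintegral => x _; case: (f x) => a b /=; rewrite mulN1r.
Qed.

End complex_integral_conj.

(** * Square-summable sequences *)

Section l2_lemmas.
Context {R : realType}.
Implicit Types x y : nat -> R[i].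

Lemma l2sqnorm_ge0 x : (0 <= l2sqnorm x)%E.
Proof. by apply: nneseries_ge0 => k _ _; rewrite lee_fin sqr_ge0. Qed.

Lemma l2sqnorm_parallelogram (t : R) x y : 0 < t ->
  (l2sqnorm (x + y)%R + t^-1%:E * l2sqnorm (fun k => t%:C * x k - y k)%R =
   (1 + t)%:E * l2sqnorm x + (1 + t^-1)%:E * l2sqnorm y)%E.
Proof.
move=> t0.
have h z k : (0%:E <= (normc (z k : R[i]) ^+ 2)%:E)%E by rewrite lee_fin sqr_ge0.
have c1 : (0%:E <= (1 + t)%:E)%E by rewrite lee_fin addr_ge0// ltW.
have c2 : (0%:E <= (1 + t^-1)%:E)%E by rewrite lee_fin addr_ge0// invr_ge0 ltW.
have c3 : (0%:E <= t^-1%:E)%E by rewrite lee_fin invr_ge0 ltW.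
rewrite /l2sqnorm -!nneseriesZl; [|by move=> *; rewrite lee_fin sqr_ge0..].
rewrite -!nneseriesD; [|by move=> *; rewrite ?mule_ge0 ?h..].
apply: eq_eseriesr => k _.
by rewrite -!EFinM -!EFinD sqr_normcD_parallelogram.
Qed.

Lemma l2sqnormZ (a : R[i]) x :
  l2sqnorm (fun k => a * x k) = ((normc a ^+ 2)%:E * l2sqnorm x)%E.
Proof.
rewrite /l2sqnorm -nneseriesZl; last by move=> *; rewrite lee_fin sqr_ge0.
by apply: eq_eseriesr => k _; rewrite -EFinM Normc.normcM exprMn.
Qed.

Lemma l2dot_single x y i : (forall k, k != i -> x k * (y k)^* = 0) ->
  l2dot x y = x i * (y i)^*.
Proof.
move=> h; rewrite /l2dot; apply: (lim_near_cst (@norm_hausdorff _ R[i]^o)).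
exists i.+1 => //= m /= im; rewrite /series/= (bigD1_seq i) /= ?mem_index_iota ?iota_uniq//.
by rewrite big1 ?addr0// => k ki; exact: h.
Qed.

(** The bridge from the inner product, a limit of complex partial sums, to a
    series of nonnegative extended reals, where sums and integrals commute. *)
Lemma l2dot_self x : in_l2 x -> l2dot x x = (fine (l2sqnorm x))%:C.
Proof.
move=> xl; rewrite /l2dot; apply: (cvg_lim (@norm_hausdorff _ R[i]^o)).
have cv : series (fun k => normc (x k) ^+ 2) n @[n --> \oo] --> fine (l2sqnorm x).
  have xf : l2sqnorm x = (fine (l2sqnorm x))%:E.
    by rewrite fineK// ge0_fin_numE ?l2sqnorm_ge0.
  have : (\sum_(0 <= k < n) (normc (x k) ^+ 2)%:E)%E @[n --> \oo]
      --> (fine (l2sqnorm x))%:E.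
    by rewrite -xf; apply: is_cvg_nneseries => k _ _; rewrite lee_fin sqr_ge0.
  move/fine_cvg; apply: cvg_trans; apply: near_eq_cvg; apply: nearW => k /=.
  by rewrite sumEFin.
apply/cvgrPdist_lt => e e0.
have [r re] : exists r, e = r%:C.
  exists (complex.Re e); apply/eqP; rewrite eq_complex /= eqxx/=.
  by move: e0; rewrite ltcE => /andP[].
rewrite re in e0 *.
move/cvgrPdist_lt : cv => /(_ r).  rewrite ltcR in e0 => /(_ e0).
apply: filterS => n.
rewrite (_ : series _ n = (series (fun k => normc (x k) ^+ 2) n)%:C).
 by rewrite -raddfB normcRe /=  expr0n addr0 sqrtr_sqr ltcR.
by rewrite /series/= rmorph_sum; apply: eq_bigr => k _; rewrite mulcJ.
Qed.

End l2_lemmas.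

(** * Analytic functions *)

Section analytic_lemmas.
Context {R : realType} {n : nat} {D : domain R n}.

Lemma analytic_continuous (V : normedModType R[i]) (f : pt D -> V) :
  analytic f -> continuous f.
Proof.
move=> af x.
have Dx : domain_set D (set_val x) by exact: set_mem (valP x).
have /differentiable_continuous cf := af _ Dx.
have fE : f = 'valL_ 0 f \o set_val by rewrite -[LHS](valLK 0).
rewrite fE; apply: continuous_comp; first exact: initial_continuous.
exact: cf.
Qed.

Lemma continuous_measurable (f : pt D -> R) :
  continuous f -> measurable_fun setT f.
Proof.
move=> /continuousP cf.
apply: (measurability (@measurable_realfun.RGenOpens.G R)).
  exact: measurable_realfun.RGenOpens.measurableE.
move=> _ [_ [a [b ->] <-]].
rewrite setTI. apply: sub_sigma_algebra. apply: cf. exact: interval_open.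
Qed.

Lemma analytic_measurable (f : pt D -> R[i]^o) : analytic f ->
 measurable_fun setT (@complex.Re R \o f) /\ measurable_fun setT (@complex.Im R \o f).
Proof.
move=> /analytic_continuous/continuousP cf.
have /continuousP cRe := @continuous_Re R.
have /continuousP cIm := @continuous_Im R.
by split; apply: continuous_measurable; apply/continuousP => A oA;
  rewrite comp_preimage; apply: cf; [exact: cRe|exact: cIm].
Qed.

End analytic_lemmas.

Section analytic_closure.
Context {R : realType} {n : nat} {D : domain R n}.

Lemma valL_in (V : Type) (v : V) (f : pt D -> V) (x : pt D) :
  'valL_ v f (set_val x) = f x.
Proof. by have := congr1 (@^~ x) (valLK v f). Qed.

Lemma valL_out (V : Type) (v : V) (f : pt D -> V) (x : 'rV[R[i]^o]_n) :
  x \notin domain_set D -> 'valL_ v f x = v.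
Proof. by move=> xD; rewrite /valL_ oinv_set_val /= insubN. Qed.

Lemma analytic_lin (a : R[i]) (f g : pt D -> R[i]) :
  analytic (f : pt D -> R[i]^o) -> analytic (g : pt D -> R[i]^o) ->
  analytic ((fun w => a * f w + g w) : pt D -> R[i]^o).
Proof.
move=> af ag z Dz.
rewrite (_ : 'valL_ 0 _ = a \*: ('valL_ 0 (f : pt D -> R[i]^o)) + 'valL_ 0 (g : pt D
  -> R[i]^o)).
  apply: differentiableD; last exact: ag.
  by apply: differentiableZ; exact: af.
apply/funext => x; rewrite !fctE /GRing.scale_fun.
have [xD|xD] := boolP (x \in domain_set D); last first.
  by rewrite !valL_out// scaler0 addr0.
by rewrite -[x]/(set_val (SigSub xD : pt D)) !valL_in.
Qed.

(** A constant on D, extended by 0 outside D, is constant only near the points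
    of D; this is why differentiability is needed in a local form. *)
Lemma near_cst_differentiable (K : numFieldType) (V W : normedModType K)
    (f : V -> W) (x : V) (c : W) : (\forall y \near x, f y = c) ->
  differentiable f x.
Proof.
move=> fc; have fx : f x = c by exact: nbhs_singleton fc.
have fo : f \o shift x = cst (f x) + (0 : V -> W) +o_ 0 id.
  apply/eqaddoP => e e0; move: fc; rewrite (near_shift 0) /=.
  apply: filterS => h /=; rewrite subr0 => fhx.
  rewrite !fctE /= fhx fx addr0 subrr normr0 mulr_ge0//.
  exact: ltW.
have c0 : continuous (0 : V -> W) by exact: cst_continuous.
have df : 'd f x = 0 :> (V -> W) by apply/diff_unique; [exact: c0|exact: fo].
by apply/diff_locallyP; rewrite df.
Qed.

Lemma analytic_cst (c : R[i]) : analytic (cst c : pt D -> R[i]^o).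
Proof.
move=> z Dz; apply: (@near_cst_differentiable R[i] 'rV[R[i]^o]_n R[i]^o ('valL_ 0 (cst c)) z c).
have : nbhs z (domain_set D) by apply: open_nbhs_nbhs; split => //; exact: domain_open.
apply: filterS => x Dx; by rewrite -[x]/(set_val (SigSub (mem_set Dx) : pt D)) valL_in.
Qed.

End analytic_closure.

(** * The Bergman space and its norm *)

Section bergman_space_lemmas.
Context {R : realType} {n : nat} {D : domain R n}.
Variable sigma : {finite_measure set (pt D) -> \bar R}.
Implicit Types F G : pt D -> nat -> R[i].

Definition energy F : \bar R := (\int[sigma]_w l2sqnorm (F w))%E.

Lemma bergman_cmeasurable F k : bergman sigma F -> cmeasurable (fun w => F w k).
Proof. by move=> [_ /(_ k)/analytic_measurable]. Qed.

Lemma measurable_l2sqnorm F : (forall k, cmeasurable (fun w => F w k)) ->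
  measurable_fun setT (fun w => l2sqnorm (F w)).
Proof.
move=> mF; apply: ge0_emeasurable_sum.
- by move=> k x _ _; rewrite lee_fin sqr_ge0.
- by move=> k _; apply/measurable_EFinP/measurable_funX/cmeasurable_normc/mF.
Qed.

Lemma energy_ge0 F : (0 <= energy F)%E.
Proof. by apply: integral_ge0 => w _; exact: l2sqnorm_ge0. Qed.

Lemma bergman_norm_sqr F : bergman sigma F ->
  ((bergman_norm sigma F ^+ 2)%:E = energy F)%E.
Proof.
move=> [l2F aF eF]; rewrite /bergman_norm /bergman_dot /=.
have -> : (\int[sigma]_w complex.Re (l2dot (F w) (F w)))%R = fine (energy F).
  congr fine; apply: eq_integral => w _.
  by rewrite l2dot_self//= fineK// ge0_fin_numE ?l2sqnorm_ge0//; exact: l2F.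
rewrite sqr_sqrtr ?fine_ge0 ?energy_ge0// fineK//.
by rewrite ge0_fin_numE ?energy_ge0.
Qed.

Lemma energy_parallelogram (t : R) F G : 0 < t ->
  (forall k, cmeasurable (fun w => F w k)) ->
  (forall k, cmeasurable (fun w => G w k)) ->
  (energy (F + G)%R + t^-1%:E * energy (fun w k => t%:C * F w k - G w k)%R =
   (1 + t)%:E * energy F + (1 + t^-1)%:E * energy G)%E.
Proof.
move=> t0 mF mG; rewrite /energy.
have c1 : (0%:E <= (1 + t)%:E)%E by rewrite lee_fin addr_ge0// ltW.
have c2 : (0%:E <= (1 + t^-1)%:E)%E by rewrite lee_fin addr_ge0// invr_ge0 ltW.
have c3 : (0%:E <= t^-1%:E)%E by rewrite lee_fin invr_ge0 ltW.
have mZ c H : (forall k, cmeasurable (fun w => H w k)) ->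
    forall k, cmeasurable (fun w => c * H w k).
  by move=> mH k; exact: (cmeasurableM (cmeasurable_cst _)).
have mB : measurable_fun setT (fun w => l2sqnorm (fun k => t%:C * F w k - G w k)).
  apply: measurable_l2sqnorm => k; apply: cmeasurableD; first exact: mZ.
  by under eq_fun do rewrite -mulN1r; exact: mZ.
have n0 (y : nat -> R[i]) : (0 <= l2sqnorm y)%E by exact: l2sqnorm_ge0.
rewrite -!ge0_integralZl//; try exact: measurable_l2sqnorm.
rewrite -!ge0_integralD//; try (by move=> w _; rewrite ?mule_ge0);
  try (by apply: measurable_funeM => //; exact: measurable_l2sqnorm).
  by apply: eq_integral => w _; exact: l2sqnorm_parallelogram.
by apply: measurable_l2sqnorm => k; exact: cmeasurableD.
Qed.

Lemma energyZ a F : (forall k, cmeasurable (fun w => F w k)) ->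
  (energy (fun w k => (a * F w k)%R) = (normc a ^+ 2)%:E * energy F)%E.
Proof.
move=> mF; rewrite /energy; under eq_integral do rewrite l2sqnormZ.
rewrite ge0_integralZl//; first exact: measurable_l2sqnorm.
- by move=> *; exact: l2sqnorm_ge0.
- by rewrite lee_fin sqr_ge0.
Qed.

Lemma bergman_add F G : bergman sigma F -> bergman sigma G ->
  bergman sigma (F + G).
Proof.
move=> bF bG; have [lF aF eF] := bF; have [lG aG eG] := bG.
have fin2 (x y : \bar R) u v : (0 <= y -> x + 1^-1%:E * y = (1 + 1)%:E * u + (1
  + 1^-1)%:E * v ->
    u < +oo -> v < +oo -> x < +oo)%E.
  move=> y0 e u1 v1; rewrite invr1 mul1e in e.
  apply: (@le_lt_trans _ _ ((1 + 1)%:E * u + (1 + 1)%:E * v)%E); first by rewrite -e leeDl.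
  by rewrite lte_add_pinfty// lte_mul_pinfty// lee_fin addr_ge0.
split.
- move=> w; apply: (fin2 _ _ _ _ _
  (l2sqnorm_parallelogram (F w) (G w) ltr01) (lF w) (lG w)).
  exact: l2sqnorm_ge0.
- move=> k; have := analytic_lin 1 (aF k) (aG k).
  by rewrite (_ : (fun w => 1 * F w k + G w k) = (fun w => (F + G) w k))//;
    apply/funext => w; rewrite mul1r.
- apply: (fin2 _ _ _ _ _ (@energy_parallelogram 1 F G ltr01 _ _) eF eG);
  first exact: energy_ge0.
    by move=> k; exact: bergman_cmeasurable.
  by move=> k; exact: bergman_cmeasurable.
Qed.

Lemma bergmanZ a F : bergman sigma F -> bergman sigma (fun w k => a * F w k).
Proof.
move=> bF; have [lF aF eF] := bF; split.
- move=> w; rewrite /in_l2 l2sqnormZ lte_mul_pinfty// ?lee_fin ?sqr_ge0//.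
  exact: lF.
- move=> k.
  have := analytic_lin a (aF k) (analytic_cst 0).
  by rewrite (_ : (fun w => _ + _) = fun w => a * F w k)//; apply/funext => w;
    rewrite addr0.
- rewrite -/(energy _) energyZ; last by move=> k; exact: bergman_cmeasurable.
  by rewrite lte_mul_pinfty// lee_fin sqr_ge0.
Qed.

Lemma bergman_coord_energy F k : bergman sigma F ->
  (\int[sigma]_w (normc (F w k) ^+ 2)%:E <= energy F)%E.
Proof.
move=> bF; apply: ge0_le_integral => //.
- by move=> w _; rewrite lee_fin sqr_ge0.
- exact/measurable_EFinP/measurable_funX/cmeasurable_normc/bergman_cmeasurable.
- by apply: measurable_l2sqnorm => j; exact: bergman_cmeasurable.
- move=> w _; rewrite /l2sqnorm (nneseriesD1 (n:=k))//.
  by rewrite leeDl// nneseries_ge0// => j _ _; rewrite lee_fin sqr_ge0.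
  by move=> j _; rewrite lee_fin sqr_ge0.
Qed.

Lemma bergman_coord F k : bergman sigma F ->
  scalar_bergman sigma (fun w => F w k).
Proof.
move=> bF; split; first by have [_ + _] := bF; exact.
by apply: le_lt_trans (bergman_coord_energy k bF) _; have [] := bF.
Qed.

End bergman_space_lemmas.

(** * Domination of weighted integrals under a change of variables *)

Section weighted_change_of_variables.
Local Open Scope ereal_scope.
Context {R : realType} {d : measure_display} {X : measurableType d}.
Variables (mu : {measure set X -> \bar R}) (v : X -> R).
Hypotheses (mv : measurable_fun setT v) (v0 : forall x, (0 <= v x)%R).

Import HBNNSimple.

Lemma ge0_integral_nnsfun_comp (g : X -> X) (h : {nnsfun X >-> R}) :
  measurable_fun setT g ->
  \int[mu]_x ((h (g x))%:E * (v x)%:E) =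
  \sum_(y \in range h) (y%:E * \int[mu]_(x in g @^-1` (h @^-1` [set y])) (v x)%:E).
Proof.
move=> mg.
have mA y : measurable (g @^-1` (h @^-1` [set y])).
  by rewrite -[X in measurable X]setTI; exact: mg.
have r0 y : y \in range h -> (0 <= y)%R by rewrite inE => -[x _ <-]; exact: fun_ge0.
have t0 y z : 0 <= y%:E * (\1_(h @^-1` [set y]) z)%:E by exact: nnfun_muleindic_ge0.
have m1 y : measurable_fun setT (fun x => (\1_(h @^-1` [set y]) (g x))%:E : \bar R).
  apply/measurable_EFinP.
  have mi : measurable_fun setT (\1_(h @^-1` [set y]) : X -> R).
    exact: measurable_indic.
  exact: (measurableT_comp mi mg).
have mt y : measurable_fun setT
    (fun x => y%:E * (\1_(h @^-1` [set y]) (g x))%:E * (v x)%:E).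
  apply: emeasurable_funM; last exact/measurable_EFinP.
  exact: measurable_funeM.
under eq_integral => x _.
  rewrite fimfunE -fsumEFin// ge0_mule_fsuml; last by move=> y; rewrite EFinM.
  under eq_fsbigr do rewrite EFinM.
  over.
rewrite ge0_integral_fsum//=.
- apply: eq_fsbigr => y yh.
  rewrite [in RHS]integral_mkcond -ge0_integralZl//.
  + apply: eq_integral => x _; rewrite -muleA; congr (_ * _).
    rewrite patchE indicE /= (_ : (g x \in h @^-1` [set y]) = (x \in g @^-1` (h @^-1`
      [set y]))).
      by case: (_ \in _); rewrite ?mul1e ?mul0e.
    by apply/idP/idP; rewrite !inE.
  + apply/(measurable_restrictT _ _).1 => //.
    by apply: measurable_funTS; exact/measurable_EFinP.
  + by move=> x _; rewrite erestrict_ge0// => z _; rewrite lee_fin.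
  + by rewrite lee_fin r0.
- by move=> y x _; rewrite mule_ge0// lee_fin.
Qed.

(** The hypothesis is the conclusion for indicators.  It passes to simple
    functions by linearity, and to all nonnegative functions by monotone
    convergence. *)
Lemma ge0_integral_comp_weight_le (phi : X -> X) (C : R) :
  measurable_fun setT phi -> (0 <= C)%R ->
  (forall A, measurable A ->
    \int[mu]_(x in phi @^-1` A) (v x)%:E <= C%:E * \int[mu]_(x in A) (v x)%:E) ->
  forall H : X -> \bar R, measurable_fun setT H -> (forall x, 0 <= H x) ->
  \int[mu]_x (H (phi x) * (v x)%:E) <= C%:E * \int[mu]_x (H x * (v x)%:E).
Proof.
move=> mphi C0 hA H mH H0.
pose h := nnsfun_approx measurableT mH.
have approx (g : X -> X) : measurable_fun setT g ->
    \int[mu]_x ((h n (g x))%:E * (v x)%:E) @[n --> \oo] -->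
    \int[mu]_x (H (g x) * (v x)%:E).
  move=> mg.
  rewrite (_ : (fun x => H (g x) * _) =
      fun x => limn (fun n => (h n (g x))%:E * (v x)%:E)); last first.
    apply/funext => x; apply/esym/cvg_lim => //; apply: cvgeZr => //.
    by apply: cvg_nnsfun_approx.
  apply: cvg_monotone_convergence => //.
  - move=> k; apply: emeasurable_funM; last exact/measurable_EFinP.
    by apply/measurable_EFinP; exact: measurableT_comp.
  - by move=> k x _; rewrite mule_ge0// lee_fin// fun_ge0.
  - move=> x _ a b ab; rewrite lee_wpmul2r ?lee_fin//.
    exact/lefP/nd_nnsfun_approx.
have h2 := approx _ (@measurable_id _ _ setT).
rewrite -(cvg_lim _ (approx _ mphi))//.
have -> : C%:E * \int[mu]_x (H x * (v x)%:E) =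
    limn (fun k => C%:E * \int[mu]_x ((h k x)%:E * (v x)%:E)).
  by apply/esym/cvg_lim => //; exact: cvgeZl.
apply: lee_lim.
- by apply/cvg_ex; eexists; exact: approx mphi.
- by apply/cvg_ex; eexists; apply: cvgeZl => //; exact: h2.
apply: nearW => k.
(* On a level set of h_k the inequality is the hypothesis. *)
rewrite ge0_integral_nnsfun_comp// (@ge0_integral_nnsfun_comp id)//.
have I0 A : 0 <= \int[mu]_(x in A) (v x)%:E.
  by apply: integral_ge0 => x _; rewrite lee_fin.
have t0 y : 0 <= y%:E * \int[mu]_(x in id @^-1` (h k @^-1` [set y])) (v x)%:E.
  have [y0|y0] := leP 0%R y; first by rewrite mule_ge0.
  rewrite [X in integral _ X _](_ : _ = set0) ?integral_set0 ?mule0//.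
  apply/seteqP; split => // x /= hxy.
  by move: y0; rewrite -hxy ltNge fun_ge0.
rewrite ge0_mule_fsumr//.
apply: lee_fsum => // y [x _ <-].
rewrite muleCA lee_wpmul2l// ?lee_fin ?fun_ge0//.
exact: hA.
Qed.

End weighted_change_of_variables.

(** * Joint measurability of separately regular functions *)

Section separate_regularity.
Context {R : realType} {n : nat} (D : domain R n).
Local Notation V := ('rV[R[i]^o]_n).

Definition rational_point (v : 'rV[rat * rat]_n) : V :=
  \row_i ((ratr (v 0 i).1 : R) +i* (ratr (v 0 i).2 : R)).

Lemma rational_point_dense (x : V) (e : R) : 0 < e ->
  exists v, ball (rational_point v) (e%:C : R[i]) x.
Proof.
move=> e0.
have appr (t : R) : {q : rat | `|ratr q - t| < e / 2}.
  apply: cid.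
  have /rat_in_itvoo[q] : t - e / 2 < t + e / 2 by lra.
  by rewrite in_itv /= => /andP[h1 h2]; exists q; rewrite ltr_norml; apply/andP; split; lra.
pose v := \row_i (sval (appr (complex.Re (x 0 i))), sval (appr (complex.Im (x 0 i)))).
exists v; split; first by rewrite ltcR.
move=> i j; rewrite -ball_normE /= normcRe ltcR mxE mxE /= (ord1 i).
have := svalP (appr (complex.Im (x 0 j))); have := svalP (appr (complex.Re (x 0 j))).
move: (sval _) (sval _) => q1 q2; case: (x 0 j) => a b /= h1 h2.
rewrite -[ltRHS](gtr0_norm e0) -sqrtr_sqr ltr_sqrt ?exprn_gt0//.
move: (_ - a) (_ - b) h1 h2 => s t; rewrite !ltr_norml => /andP[? ?] /andP[? ?].
nra.
Qed.

Definition pickle_point (j : nat) : V :=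
  if unpickle j is Some v then rational_point v else 0.

Let rad (m : nat) : R[i] := (m.+1%:R^-1 : R)%:C.

(** The grid point of index j is within 1 / (m + 1) of z.  Replacing z by some
    point of D that shares the least such j moves z by less than 2 / (m + 1) and
    leaves countably many values; this approximates the identity of D by
    measurable maps even though the grid points need not lie in D. *)
Definition cell (m : nat) (z : pt D) (j : nat) : bool :=
  `[< ball (pickle_point j) (rad m) (set_val z) >].

Lemma cell_ex m z : exists j, cell m z j.
Proof.
have [|v hv] := @rational_point_dense (set_val z) (m.+1%:R^-1).
  by rewrite invr_gt0.
by exists (pickle v); apply/asboolP; rewrite /pickle_point pickleK.
Qed.

Definition cell_index m z := ex_minn (cell_ex m z).

Definition cell_point (m j : nat) : pt D :=
  xget (origin D) [set z | cell m z j].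

Lemma cell_measurable m j : measurable [set z | cell m z j].
Proof.
apply: sub_sigma_algebra.
exists (ball (pickle_point j) (rad m)); first exact: ball_open.
by apply/seteqP; split => z /=; rewrite /cell => /asboolP.
Qed.

Lemma cell_index_measurable m j : measurable [set z | cell_index m z = j].
Proof.
rewrite (_ : [set z | _] = [set z | cell m z j] `\`
   \bigcup_(i in [set i | (i < j)%N]) [set z | cell m z i]).
  apply: measurableD; first exact: cell_measurable.
  by apply: bigcup_measurable => i _; exact: cell_measurable.
apply/seteqP; split => [z <-|z [/= czj zj]] /=; rewrite /cell_index;
  case: ex_minnP => k ck mk.
  by split => // -[i /= ik /mk]; rewrite leqNgt ik.
apply/eqP; rewrite eqn_leq mk//= leqNgt; apply/negP => kj.
by apply: zj; exists k.
Qed.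

Lemma cell_point_cvg (z : pt D) :
  cell_point m (cell_index m z) @[m --> \oo] --> z.
Proof.
move=> A [_ [[U oU <-] Uz UA]].
have /nbhs_ballP[e /= e0 zeU] : nbhs (set_val z) U by exact: open_nbhs_nbhs.
have [r re] : exists r, e = r%:C.
  exists (complex.Re e); apply/eqP; rewrite eq_complex /= eqxx/=.
  by move: e0; rewrite ltcE => /andP[].
rewrite re in e0 zeU *; rewrite ltcR in e0.
have r2 : 0 < r / 2 by rewrite divr_gt0.
have := near_infty_natSinv_lt (PosNum r2); apply: filterS => m /= mr.
apply: UA; apply: zeU.
rewrite /cell_point; case: xgetP => [y _ /= /asboolP cy|]; last first.
  move=> /(_ z)[]; rewrite /cell_index; by case: ex_minnP.
have /asboolP cz : cell m z (cell_index m z).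
  by rewrite /cell_index; case: ex_minnP.
have rle : rad m <= r%:C / 2.
  by rewrite (_ : r%:C / 2 = (r / 2)%:C) ?lecR ?ltW// rmorphM/= fmorphV/= rmorph_nat.
exact: (ball_splitr (le_ball rle cz) (le_ball rle cy)).
Qed.

(** Caratheodory functions are jointly measurable: with z replaced by its
    representative in the m-th grid, f becomes a countable union of pieces
    measurable in w alone, and these approximations converge to f by
    continuity in z. *)
Lemma measurable_separately_continuous (f : pt D -> pt D -> R) :
  (forall z, measurable_fun setT (f z)) -> (forall w, continuous (f ^~ w)) ->
  measurable_fun setT (fun zw : pt D * pt D => f zw.1 zw.2).
Proof.
move=> mf cf.
pose g m (zw : pt D * pt D) := f (cell_point m (cell_index m zw.1)) zw.2.
apply: (@measurable_fun_cvg _ _ _ _ g) => //.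
  move=> m _ Y mY; rewrite setTI.
  rewrite (_ : _ @^-1` _ = \bigcup_j ([set z | cell_index m z = j] `*`
     (f (cell_point m j) @^-1` Y))).
    apply: bigcupT_measurable => j; apply: measurableX.
      exact: cell_index_measurable.
    by rewrite -[X in measurable X]setTI; exact: mf.
  apply/seteqP; split => [[z w] /= Yg|[z w] [j _ [/= <-]]//].
  by exists (cell_index m z).
move=> [z w] _; rewrite /g /=.
exact: (cvg_comp (fun m => cell_point m (cell_index m z)) (f ^~ w)
  (@cell_point_cvg z) (cf w z)).
Qed.

End separate_regularity.

(** * A Schur test for matrices of integral kernels *)

Lemma measurable_invr_ge0 (R : realType) (d : measure_display)
    (X : measurableType d) (f : X -> R) : (forall u, 0 <= f u) ->
  measurable_fun setT f -> measurable_fun setT (fun u => (f u)^-1).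
Proof.
move=> f0 mf; have := measurableT_comp (measurable_powR (-1)) mf.
by apply: eq_measurable_fun => u _ /=; rewrite powR_inv1.
Qed.

(** The hypothesis is Young's inequality with all weights t; the choice
    t = g / a turns it into the Cauchy-Schwarz inequality. *)
Lemma le_sqr_of_young (R : realType) (g a q : R) : 0 <= g -> 0 < a ->
  (forall t, 0 < t -> 2 * g <= t * a + t^-1 * q) -> 0 <= q ->
  g ^+ 2 <= a * q.
Proof.
rewrite le_eqVlt => /predU1P[<-|g0] a0 H q0.
  by rewrite expr0n mulr_ge0// ltW.
have := H (g / a) (divr_gt0 g0 a0); rewrite divfK ?gt_eqF// invf_div => H1.
have {}H1 : (g <= a / g * q) by lra.
have := ler_wpM2l (ltW g0) H1.
by rewrite -expr2 (_ : g * (a / g * q) = a * q)//; field; rewrite gt_eqF.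
Qed.

Section schur_test.
Local Open Scope ereal_scope.
Context {R : realType} {d : measure_display} {X : measurableType d}.
Variable mu : {sigma_finite_measure set X -> \bar R}.

Variables (A : nat -> nat -> X -> X -> R) (h : X -> R) (C : R).
Hypothesis A0 : forall i k z w, (0 <= A i k z w)%R.
Hypothesis mA : forall i k, measurable_fun setT (fun zw : X * X => A i k zw.1 zw.2).
Hypothesis h0 : forall z, (0 < h z)%R.
Hypothesis mh : measurable_fun setT h.
Hypothesis C0 : (0 < C)%R.
Hypothesis rowA : forall i z,
  \sum_(k <oo) \int[mu]_w (A i k z w * h w)%:E <= (C * h z)%:E.
Hypothesis colA : forall k w,
  \sum_(i <oo) \int[mu]_z (A i k z w * h z)%:E <= (C * h w)%:E.

Variables (F g : X -> nat -> R).
Hypothesis F0 : forall w k, (0 <= F w k)%R.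
Hypothesis g0 : forall w k, (0 <= g w k)%R.
Hypothesis mF : forall k, measurable_fun setT (F ^~ k).
Hypothesis mg : forall k, measurable_fun setT (g ^~ k).
Hypothesis gF : forall i z, (g z i)%:E <= \sum_(k <oo) \int[mu]_w (A i k z w * F w k)%:E.

Let P i k z w : R := (h z * A i k z w * (F w k ^+ 2 / h w))%R.

Let P0 i k z w : (0 <= P i k z w)%R.
Proof.
apply: mulr_ge0; first by rewrite mulr_ge0// ltW.
by rewrite divr_ge0 ?sqr_ge0// ltW.
Qed.

Let mArow i k z : measurable_fun setT (A i k z).
Proof. exact: (measurableT_comp (mA i k) (pair1_measurable z)). Qed.

Let mAcol i k w : measurable_fun setT (fun z => A i k z w).
Proof. exact: (measurableT_comp (mA i k) (pair2_measurable w)). Qed.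

Let mFh k : measurable_fun setT (fun w => F w k ^+ 2 / h w)%R.
Proof.
apply: measurable_funM; first exact: measurable_funX.
by apply: measurable_invr_ge0 => // u; exact: ltW.
Qed.

Let mP i k : measurable_fun setT (fun zw : X * X => (P i k zw.1 zw.2)%:E).
Proof.
apply/measurable_EFinP; apply: measurable_funM.
  apply: measurable_funM; last exact: mA.
  exact: (measurableT_comp mh measurable_fst).
exact: (measurableT_comp (mFh k) measurable_snd).
Qed.

(** Cauchy-Schwarz for the sum over k of the integrals against A, obtained from
    2 F <= t h + F^2 / (t h): integrating this against A and using the row
    condition gives the hypothesis of [le_sqr_of_young] with a = C h(z). *)
Lemma schur_pointwise i z :
  ((g z i ^+ 2)%:E <= C%:E * \sum_(k <oo) \int[mu]_w (P i k z w)%:E)%E.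
Proof.
pose Q := \sum_(k <oo) \int[mu]_w (A i k z w * (F w k ^+ 2 / h w))%:E.
have mAF k : measurable_fun setT (fun w => (A i k z w * (F w k ^+ 2 / h w))%:E).
  by apply/measurable_EFinP; apply: measurable_funM.
have AF0 k w : (0 <= A i k z w * (F w k ^+ 2 / h w))%R.
  by rewrite mulr_ge0// divr_ge0 ?sqr_ge0// ltW.
have mAh k : measurable_fun setT (fun w => (A i k z w * h w)%:E).
  by apply/measurable_EFinP; apply: measurable_funM.
have Ah0 k w : (0 <= A i k z w * h w)%R by rewrite mulr_ge0// ltW.
have Q0 : 0 <= Q.
  by apply: nneseries_ge0 => k _ _; apply: integral_ge0 => w _; rewrite lee_fin.
have -> : C%:E * \sum_(k <oo) \int[mu]_w (P i k z w)%:E = (C * h z)%:E * Q.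
  rewrite EFinM -muleA; congr (_ * _).
  rewrite -nneseriesZl; last first.
    by move=> k _; apply: integral_ge0 => w _; rewrite lee_fin.
  apply: eq_eseriesr => k _; rewrite -ge0_integralZl//.
  - by apply: eq_integral => w _; rewrite -EFinM /P !mulrA.
  - by move=> w _; rewrite lee_fin.
  - by rewrite lee_fin ltW.
have young t : (0 < t)%R -> (2 * g z i)%:E <= t%:E * (C * h z)%:E + t^-1%:E * Q.
  move=> t0; rewrite EFinM.
  apply: (@le_trans _ _ (2%:E * \sum_(k <oo) \int[mu]_w (A i k z w * F w k)%:E)).
    by apply: lee_wpmul2l.
  apply: (@le_trans _ _ (t%:E * \sum_(k <oo) \int[mu]_w (A i k z w * h w)%:E
    + t^-1%:E * Q)); last first.
    by rewrite leeD2r// lee_wpmul2l// lee_fin ltW.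
  have I0 (f : nat -> X -> R) : (forall k w, 0 <= f k w)%R ->
      forall k, 0 <= \int[mu]_w (f k w)%:E.
    by move=> f0 k; apply: integral_ge0 => w _; rewrite lee_fin.
  have t0' : 0 <= t%:E by rewrite lee_fin ltW.
  have t1' : 0 <= t^-1%:E by rewrite lee_fin invr_ge0 ltW.
  have Af0 k w : (0 <= A i k z w * F w k)%R by rewrite mulr_ge0.
  have mAf k : measurable_fun setT (fun w => (A i k z w * F w k)%:E).
    by apply/measurable_EFinP; apply: measurable_funM.
  have IAf := I0 _ Af0; have IAF := I0 _ AF0; have IAh := I0 _ Ah0.
  rewrite -!nneseriesZl// -nneseriesD//; try (by move=> k _; rewrite mule_ge0).
  apply: lee_nneseries; first by move=> k _ _; rewrite mule_ge0.
  move=> k _.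
  rewrite -!ge0_integralZl//; try (by move=> w _; rewrite lee_fin).
  rewrite -ge0_integralD//; try (by move=> w _; rewrite mule_ge0// lee_fin);
    try exact: measurable_funeM.
  apply: ge0_le_integral => //.
  - by move=> w _; rewrite mule_ge0// lee_fin.
  - exact: measurable_funeM.
  - by apply: emeasurable_funD; exact: measurable_funeM.
  move=> w _; rewrite -!EFinM -EFinD lee_fin.
  have hw := h0 w; have := A0 i k z w; have := F0 w k.
  move: (A i k z w) (F w k) (h w) hw => a f x x0 f0 a0.
  have -> : (t * (a * x) + t^-1 * (a * (f ^+ 2 / x)) = 2 * (a * f)
    + a * (t * x - f) ^+ 2 / (t * x))%R.
    by field; rewrite !gt_eqF.
  rewrite lerDl; apply: divr_ge0; first by rewrite mulr_ge0 ?sqr_ge0.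
  by apply: mulr_ge0; exact: ltW.
have Ch0 : (0 < C * h z)%R by rewrite mulr_gt0.
clearbody Q; move: Q Q0 young; case=> [q|_ _|//]; first move=> q0 H.
- rewrite lee_fin in q0; rewrite -EFinM lee_fin.
  by apply: le_sqr_of_young => //; exact: g0.
- by rewrite gt0_muley ?leey// lte_fin.
Qed.

(** The matrix A acts boundedly on l^2-valued L^2 functions.  Integrate
    [schur_pointwise] in z, exchange all sums and integrals, and sum over i
    first: the column condition cancels the weight 1 / h. *)
Lemma schur_test :
  \sum_(i <oo) \int[mu]_z (g z i ^+ 2)%:E <=
  (C ^+ 2)%:E * \sum_(k <oo) \int[mu]_w (F w k ^+ 2)%:E.
Proof.
have I0 i k : 0 <= \int[mu]_z \int[mu]_w (P i k z w)%:E.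
  by apply: integral_ge0 => z _; apply: integral_ge0 => w _; rewrite lee_fin.
have Pxy0 i k (zw : X * X) : 0 <= (P i k zw.1 zw.2)%:E by rewrite lee_fin.
have J0 i k z : 0 <= \int[mu]_w (P i k z w)%:E.
  by apply: integral_ge0 => w _; rewrite lee_fin.
have mJ i k : measurable_fun setT (fun z => \int[mu]_w (P i k z w)%:E).
  exact: (@measurable_fun_fubini_tonelli_F _ _ _ _ _ mu (fun zw => (P i k zw.1 zw.2)%:E)
    (mP i k) (Pxy0 i k)).
have J0' i k w : 0 <= \int[mu]_z (P i k z w)%:E.
  by apply: integral_ge0 => z _; rewrite lee_fin.
have mJ' i k : measurable_fun setT (fun w => \int[mu]_z (P i k z w)%:E).
  exact: (@measurable_fun_fubini_tonelli_G _ _ _ _ _ mu (fun zw => (P i k zw.1 zw.2)%:E)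
    (mP i k) (Pxy0 i k)).
have swap i k : \int[mu]_z \int[mu]_w (P i k z w)%:E = \int[mu]_w \int[mu]_z (P i k z w)%:E.
  exact: (@fubini_tonelli _ _ _ _ _ mu mu (fun zw => (P i k zw.1 zw.2)%:E) (mP i k)
    (Pxy0 i k)).
apply: (@le_trans _ _ (\sum_(i <oo) (C%:E * \sum_(k <oo) \int[mu]_z \int[mu]_w (P i k z w)%:E))).
  apply: lee_nneseries => [i _ _|i _].
    by apply: integral_ge0 => z _; rewrite lee_fin sqr_ge0.
  rewrite -integral_nneseries// -ge0_integralZl//; last 3 first.
  - exact: ge0_emeasurable_sum.
  - by move=> z _; exact: nneseries_ge0.
  - by rewrite lee_fin ltW.
  apply: ge0_le_integral => //.
  - by move=> z _; rewrite lee_fin sqr_ge0.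
  - by apply/measurable_EFinP; exact: measurable_funX.
  - by apply: measurable_funeM; exact: ge0_emeasurable_sum.
  - by move=> z _; exact: schur_pointwise.
rewrite nneseriesZl; last by move=> i _; exact: nneseries_ge0.
rewrite expr2 EFinM -muleA; apply: lee_wpmul2l; first by rewrite lee_fin ltW.
rewrite nneseries_interchange// -nneseriesZl; last first.
  by move=> k _; apply: integral_ge0 => w _; rewrite lee_fin sqr_ge0.
apply: lee_nneseries => [k _ _|k _]; first exact: nneseries_ge0.
under eq_eseriesr do rewrite swap.
rewrite -integral_nneseries// -ge0_integralZl//; last 3 first.
- by apply/measurable_EFinP; exact: measurable_funX.
- by move=> w _; rewrite lee_fin sqr_ge0.
- by rewrite lee_fin ltW.
apply: ge0_le_integral => //.
- by move=> w _; exact: nneseries_ge0.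
- exact: ge0_emeasurable_sum.
- by apply: measurable_funeM; apply/measurable_EFinP; exact: measurable_funX.
move=> w _.
have Fh0 : (0 <= F w k ^+ 2 / h w)%R by rewrite divr_ge0 ?sqr_ge0// ltW.
apply: (@le_trans _ _ ((F w k ^+ 2 / h w)%:E * (C * h w)%:E)); last first.
  by rewrite -!EFinM lee_fin mulrCA divfK ?gt_eqF.
apply: le_trans (lee_wpmul2l _ (colA k w)); last by rewrite lee_fin.
rewrite -nneseriesZl; last first.
  by move=> i _; apply: integral_ge0 => z _; rewrite lee_fin mulr_ge0// ltW.
rewrite le_eqVlt; apply/orP; left; apply/eqP; apply: eq_eseriesr => i _.
rewrite -ge0_integralZl//.
- apply: eq_integral => z _; rewrite -EFinM /P mulrC; congr (_ * _)%:E.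
  by rewrite mulrC.
- by apply/measurable_EFinP; apply: measurable_funM.
- by move=> z _; rewrite lee_fin mulr_ge0// ltW.
Qed.

End schur_test.

(** * Reproducing kernels *)

Section kernel_lemmas.
Context {R : realType} {n : nat} (B : bergman_space R n).
Local Notation sigma := (Defs.sigma B).
Local Notation K := (Defs.K B).
Local Notation phi := (Defs.phi B).

Lemma scalar_cmeasurable f : scalar_bergman sigma f -> cmeasurable f.
Proof. by move=> [/analytic_measurable]. Qed.

Lemma K_cmeasurable z : cmeasurable (K z).
Proof. exact: scalar_cmeasurable (K_bergman z). Qed.

Lemma scalar_dot_K z w : scalar_dot sigma (K z) (K w) = K z w.
Proof.
rewrite (K_scalar_reproducing w (K_bergman z)) /scalar_dot.
by congr complex_integral; apply/funext => x; rewrite mulrC.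
Qed.

Lemma K_norm_ge0 z : 0 <= norm B z.
Proof. exact: sqrtr_ge0. Qed.

Lemma K_energy z : ((norm B z ^+ 2)%:E = \int[sigma]_w (normc (K z w) ^+ 2)%:E)%E.
Proof.
have [aK eK] := K_bergman z.
rewrite /scalar_norm /scalar_dot /=.
have -> : (\int[sigma]_w complex.Re (K z w * (K z w)^*))%R =
    fine (\int[sigma]_w (normc (K z w) ^+ 2)%:E)%E.
  by congr fine; apply: eq_integral => w _; rewrite mulcJ.
have e0 : (0 <= \int[sigma]_w (normc (K z w) ^+ 2)%:E)%E.
  by apply: integral_ge0 => w _; rewrite lee_fin sqr_ge0.
by rewrite sqr_sqrtr ?fine_ge0// fineK// ge0_fin_numE.
Qed.

Lemma scalar_bergman1 : scalar_bergman sigma (cst 1).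
Proof.
split; first exact: analytic_cst.
under eq_integral do rewrite [normc _]normc_one expr1n.
by rewrite integral_cst// mul1e ltey_eq fin_num_measure.
Qed.

(** The constant 1 lies in the space because sigma is finite, so K_z reproduces
    it at z and cannot vanish. *)
Lemma K_norm_gt0 z : 0 < norm B z.
Proof.
rewrite lt_neqAle K_norm_ge0 andbT eq_sym; apply/negP => /eqP K0.
have mK := K_cmeasurable z.
have eK : (\int[sigma]_w (normc (K z w) ^+ 2)%:E = 0)%E.
  by rewrite -K_energy K0 expr0n.
have I1 : (\int[sigma]_w (normc (cst 1 w : R[i]) ^+ 2)%:E < +oo)%E by have
  [] := scalar_bergman1.
have cI : cintegrable sigma (fun w => (K z w)^* * cst 1 w).
  apply: cintegrable_mul => //; first exact: cmeasurableJ.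
    exact: cmeasurable_cst.
  under eq_integral do rewrite normcJ.
  by rewrite eK.
have := complex_integral_norm_le cI.
rewrite -(K_scalar_reproducing z scalar_bergman1) [normc _]normc_one.
have [M M0 sM] : exists2 M : R, 0 < M & (sigma setT <= M%:E)%E.
  exists (fine (sigma setT) + 1); first by rewrite ltr_wpDl// fine_ge0.
  by rewrite EFinD fineK ?fin_num_measure// leeDl.
(* If K_z had norm 0, then |K_z| <= M |K_z|^2 + 1 / (4 M), with M at least the
   total mass, would bound the integral of |K_z| by 1/4, against 1 <= 2 * 1/4. *)
suff : (\int[sigma]_x (normc ((K z x)^* * cst 1 x))%:E <= (1/4)%:E)%E.
  move=> h1 h2; have h3 : (0%:E <= 2%:E :> \bar R)%E by rewrite lee_fin.
  by have := le_trans h2 (lee_wpmul2l h3 h1); rewrite -EFinM lee_fin; lra.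
apply: (@le_trans _ _ (\int[sigma]_x (M%:E * (normc (K z x) ^+ 2)%:E
  + (1 / (4 * M))%:E))%E).
  apply: ge0_le_integral => //.
  - by move=> x _; rewrite lee_fin normc_ge0.
  - exact/measurable_EFinP/cmeasurable_normc/(proj1 cI).
  - apply: emeasurable_funD => //; apply: measurable_funeM.
    exact/measurable_EFinP/measurable_funX/cmeasurable_normc.
  - move=> x _; rewrite mulr1 normcJ -EFinM -EFinD lee_fin.
    have : 0 <= (2 * M * normc (K z x) - 1)^+2 by exact: sqr_ge0.
    rewrite -(ler_pM2l (x := 4 * M)) ?mulr_gt0// mulrDr mulrA.
    rewrite (_ : 4 * M * (1 / (4 * M)) = 1); first by nra.
    by field; rewrite gt_eqF.
rewrite ge0_integralD//.
- rewrite ge0_integralZl// ?eK ?mule0 ?add0e.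
  + rewrite integral_cst//; apply: le_trans (lee_wpmul2l _ sM) _.
      by rewrite lee_fin divr_ge0// mulr_ge0// ltW.
    by rewrite -EFinM lee_fin mul1r invfM -mulrA mulVf ?gt_eqF// mulr1 mul1r.
  + exact/measurable_EFinP/measurable_funX/cmeasurable_normc.
  + by move=> x _; rewrite lee_fin sqr_ge0.
  + by rewrite lee_fin ltW.
- by move=> x _; rewrite -EFinM lee_fin mulr_ge0 ?sqr_ge0// ltW.
- apply: measurable_funeM.
  exact/measurable_EFinP/measurable_funX/cmeasurable_normc.
- by move=> x _; rewrite lee_fin divr_ge0// mulr_ge0// ltW.
Qed.

(** The topology of the metric need not be the Euclidean one that generates the
    sigma-algebra.  By separability, an open set of the metric is still a
    countable union of balls, which are Borel sets. *)
Lemma dist_open_measurable (A : set (metric_space (Defs.dist B))) :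
  open A -> measurable (A : set (pt B)).
Proof.
move=> oA; have [S cS dS] := dist_separable B.
have /countable_injP[f fi] := cS.
pose c (k : nat) : pt B := xget (origin B) [set s | S s /\ f s = k].
pose r (m : nat) : R := m.+1%:R^-1.
pose ok k m := [set u | Defs.dist B (c k) u < r m] `<=` A.
rewrite (_ : A = \bigcup_k \bigcup_(m in [set m | ok k m])
   [set u | Defs.dist B (c k) u < r m]).
  apply: bigcupT_measurable => k; apply: bigcup_measurable => m _.
  exact: dist_ball_measurable.
apply/seteqP; split => [x Ax|x [k _ [m okm]]]; last exact: okm.
have : nbhs (x : metric_space (Defs.dist B)) A by exact: open_nbhs_nbhs.
move=> /nbhs_ballP[e /= e0 xeA].
have [m me] : exists m : nat, r m < e / 2.
  have e2 : 0 < e / 2 by rewrite divr_gt0.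
  have [m _ /(_ m (leqnn m))] := near_infty_natSinv_lt (PosNum e2).
  by exists m.
have m0 : 0 < r m by rewrite invr_gt0.
have [s [/= /interior_subset xs Ss]] :
    interior (ball (x : metric_space (Defs.dist B)) (r m)) `&` S !=set0.
  apply: dS; last exact: open_interior.
  by exists x; exact: nbhsx_ballx.
have cs : c (f s) = s.
  rewrite /c; case: xgetP => [y _ [Sy fy]|/(_ s)[]//].
  by apply: fi => //; exact: mem_set.
exists (f s) => //; exists m => /=; last by rewrite cs metric_distC.
rewrite /ok cs.
move=> u /= su; apply: xeA.
suff : Defs.dist B x u < e by [].
apply: le_lt_trans (metric_dist_triangle _ s _ _) _.
rewrite [ltRHS](splitr e) ltrD//; last exact: lt_trans su me.
by apply: lt_trans me; exact: xs.
Qed.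

Lemma K_norm_measurable : measurable_fun setT (fun z : pt B => norm B z).
Proof.
have /continuousP cN := @K_norm_continuous _ _ B.
apply: (measurability (@RGenOpens.G R)); first exact: RGenOpens.measurableE.
move=> _ [_ [a [b ->] <-]]; rewrite setTI.
by apply: dist_open_measurable; apply: cN; exact: interval_open.
Qed.

Lemma phi_measurable z : measurable_fun setT (phi z).
Proof.
have [g [_ _ /analytic_continuous/continuousP cphi _]] := phi_aut z.
apply: (measurability (@open (pt B))) => //.
move=> _ [_ [U oU <-] <-]; rewrite setTI.
apply: sub_sigma_algebra; rewrite -comp_preimage; exact: cphi.
Qed.

End kernel_lemmas.

Section kernel_estimates.
Context {R : realType} {n : nat} (B : bergman_space R n).
Local Notation sigma := (Defs.sigma B).
Local Notation K := (Defs.K B).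
Local Notation phi := (Defs.phi B).
Local Notation k := (normalized_kernel sigma K).

Lemma normc_real (x : R) : normc (x%:C : R[i]) = `|x|.
Proof. by rewrite /= expr0n addr0 sqrtr_sqr. Qed.

Lemma normc_normalized_kernel z w : normc (k z w) = normc (K z w) / norm B z.
Proof.
by rewrite /normalized_kernel Normc.normcM Normc.normcV normc_real ger0_norm ?K_norm_ge0.
Qed.

Lemma K_cintegrable z w : cintegrable sigma (fun x => K z x * (K w x)^*).
Proof.
apply: cintegrable_mul; [exact: K_cmeasurable|exact/cmeasurableJ/K_cmeasurable| |].
  by rewrite -K_energy ltry.
by under eq_integral do rewrite normcJ; rewrite -K_energy ltry.
Qed.

Lemma normc_dot_normalized_kernel z w :
  normc (scalar_dot sigma (k z) (k w)) = normc (K z w) / (norm B z * norm B w).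
Proof.
rewrite /scalar_dot (_ : (fun x => _) = (fun x => ((norm B z)%:C^-1 * ((norm B w)%:C^-1)^*)
    * (K z x * (K w x)^*))); last first.
  apply/funext => x; rewrite /normalized_kernel [X in _ * X = _]rmorphM /=.
  by rewrite mulrACA mulrC.
rewrite complex_integralZ; last exact: K_cintegrable.
rewrite -/(scalar_dot sigma (K z) (K w)) scalar_dot_K !Normc.normcM normcJ.
rewrite !Normc.normcV !normc_real !ger0_norm ?K_norm_ge0//.
by rewrite mulrC invfM.
Qed.

(** The second bound is the estimate of <k_z, k_w>.  The first is the estimate
    of <k_z, k_u> at u = phi_z(w), where 1 / ||K_{phi_z(u)}|| = 1 / ||K_w||
    because phi_z is an involution. *)
Lemma K_norm_phi_bounds : exists2 c : R, 0 < c & forall z w,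
  norm B (phi z w) <= c * norm B w * normc (k z (phi z w)) /\
  (norm B (phi z w))^-1 <= c * normc (K z w) / (norm B z * norm B w).
Proof.
have [c c0 H] := normalized_kernel_dot B; exists c => // z w; split.
  have [_] := H z (phi z w); rewrite phi_involution.
  rewrite normc_dot_normalized_kernel normc_normalized_kernel div1r.
  have Nw := K_norm_gt0 w; have NM := K_norm_gt0 (phi z w); have NZ := K_norm_gt0 z.
  rewrite -(ler_pM2l (mulr_gt0 Nw NM)).
  rewrite [leLHS]mulrAC divff ?gt_eqF// mul1r => /le_trans; apply.
  by rewrite le_eqVlt; apply/orP; left; apply/eqP; field; rewrite !gt_eqF.
have [_] := H z w; rewrite normc_dot_normalized_kernel div1r => /le_trans; apply.
by rewrite mulrA.
Qed.

(** As phi_z is an involution, preimages under phi_z are images, so the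
    quasi-invariance of lambda applies to them. *)
Lemma lambda_change_of_variables : exists2 C : R, 0 < C &
  forall z (H : pt B -> \bar R), measurable_fun setT H -> (forall x, 0 <= H x)%E ->
  (\int[sigma]_w (H (phi z w) * (norm B w ^+ 2)%:E) <=
   C%:E * \int[sigma]_w (H w * (norm B w ^+ 2)%:E))%E.
Proof.
have [C C0 hC] := lambda_quasi_invariant B; exists C => // z H mH H0.
apply: ge0_integral_comp_weight_le => //.
- by apply: measurable_funX; exact: K_norm_measurable.
- by move=> x; exact: sqr_ge0.
- exact: phi_measurable.
- exact: ltW.
- move=> A mA; have [_] := hC z _ mA.
  have -> : phi z @` A = phi z @^-1` A; last by [].
  apply/seteqP; split => [_ [x Ax <-]|x Ax] /=; first by rewrite phi_involution.
  by exists (phi z x) => //; rewrite phi_involution.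
Qed.

Definition l1norm (x : nat -> R[i]) : \bar R := (\sum_(j <oo) (normc (x j))%:E)%E.

Lemma l1norm_ge0 x : (0 <= l1norm x)%E.
Proof. by apply: nneseries_ge0 => j _ _; rewrite lee_fin normc_ge0. Qed.

Lemma measurable_l1norm (F : pt B -> nat -> R[i]) :
  (forall j, cmeasurable (fun w => F w j)) ->
  measurable_fun setT (fun w => l1norm (F w)).
Proof.
move=> mF; apply: ge0_emeasurable_sum => [j x _ _|j _].
  by rewrite lee_fin normc_ge0.
exact/measurable_EFinP/cmeasurable_normc/mF.
Qed.

Lemma l2dot_l2basis (x : nat -> R[i]) j : l2dot x (l2basis j) = x j.
Proof.
rewrite (@l2dot_single _ _ _ j) /l2basis.
  by rewrite eqxx rmorph1 mulr1.
by move=> i /negbTE ->; rewrite rmorph0 mulr0.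
Qed.

Lemma l1norm_translation z F u :
  (\sum_(j <oo) (normc (l2dot (translation z F u) (l2basis j)))%:E =
   l1norm (F (phi z u)) * (normc (k z u))%:E)%E.
Proof.
rewrite muleC -nneseriesZl; last by move=> j _; rewrite lee_fin normc_ge0.
apply: eq_eseriesr => j _.
by rewrite l2dot_l2basis /translation Normc.normcM -EFinM mulrC.
Qed.

End kernel_estimates.

(** * The weighted estimate *)

Section exponents.
Context {R : realType}.

(** With q the conjugate exponent of p and b = a q, the conditions
    0 < b - 2 q + 2 < k < 2 - b say that b lies between 2 q - 2 and the smaller
    of 2 - k and 2 q - 2 + k.  This interval is nonempty as soon as 2 q < 4 - k,
    which is the assumption on p. *)
Lemma schur_exponent (k p : R) : 0 <= k < 2 -> (4 - k) / (2 - k) < p ->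
  [/\ 2 < p, 1 < p / (p - 1), p / (p - 1) < 2 &
   exists a : R, k < 2 - a * (p / (p - 1)) /\
     (0 < k -> 0 < a * (p / (p - 1)) - 2 * (p / (p - 1)) + 2 < k) /\
     (k = 0 -> 2 - a * (p / (p - 1)) = a * (p / (p - 1)) - 2 * (p / (p - 1)) + 2)].
Proof.
move=> /andP[k0 k2]; rewrite ltr_pdivrMr ?subr_gt0// => hp.
have p2 : 2 < p by rewrite ltNge; apply/negP => p2; nra.
have p10 : 0 < p - 1 by lra.
set q := p / (p - 1).
have qE : q * (p - 1) = p by rewrite /q mulfVK// gt_eqF.
have q1 : 1 < q by nra.
have q2 : q < 2 by nra.
have q_half : 2 * q - 2 < 2 - k by nra.
split => //.
have q0 : q != 0 by rewrite gt_eqF//; lra.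
have [k00|k00] := eqVneq k 0.
  by exists 1; rewrite k00 mul1r; split; [lra|split; lra].
have {}k0 : 0 < k by rewrite lt_neqAle eq_sym k00.
pose m := Num.min (2 - k) (2 * q - 2 + k).
have hm : 2 * q - 2 < m by rewrite /m lt_min q_half/=; lra.
have m1 : m <= 2 - k by rewrite /m ge_min lexx.
have m2 : m <= 2 * q - 2 + k by rewrite /m ge_min lexx orbT.
exists ((2 * q - 2 + m) / 2 / q); rewrite mulfVK//.
split; first by lra.
split; last by move=> k000; rewrite k000 ltxx in k0.
by move=> _; apply/andP; split; lra.
Qed.

(** Here Z, N, M, k, d stand for ||K_z||, ||K_w||, ||K_{phi_z(w)}||,
    |k_z(phi_z(w))| and |<K_z, K_w>|.  The left-hand side is the product of
    S M^(1 - 2/p) N^(2/p - 1) and Z^(1 - a) N^(a + 1 - 2/p) M^(2/p - 1); Young's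
    inequality with exponents p and q bounds it by the sum of their powers, and
    the two bounds on M turn these powers into the right-hand side. *)
Lemma young_pointwise (p q r s a c Z N M k d S : R) :
  2 < p -> 0 < c -> 0 < Z -> 0 < N -> 0 < M -> 0 <= k -> 0 <= d -> 0 < S ->
  M <= c * N * k -> M^-1 <= c * d / (Z * N) ->
  q = p / (p - 1) -> r = 2 - a * q -> s = a * q - 2 * q + 2 ->
  Z `^ (1 - a) * S * N `^ a <=
    c `^ p * (S `^ p * k `^ p * (M ^+ 2)^-1 * N ^+ 2) +
    c `^ (2 - q) * (d `^ ((r + s) / 2) / (Z `^ s * N `^ r) * N ^+ 2).
Proof.
move=> p2 c0 Z0 N0 M0 k0 d0 S0 Mle Mge qdef rE sE.
have {}k0 : 0 < k.
  rewrite lt_neqAle k0 andbT eq_sym; apply/eqP => k00.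
  by move: Mle; rewrite k00 mulr0 leNgt M0.
have {}d0 : 0 < d.
  rewrite lt_neqAle d0 andbT eq_sym; apply/eqP => d00.
  by move: Mge; rewrite d00 mulr0 mul0r leNgt invr_gt0 M0.
have ex (x : R) : 0 < x -> exists lx, x = expR lx.
  by move=> x0; exists (ln x); rewrite lnK ?posrE.
have [lc cE] := ex _ c0; have [lZ ZE] := ex _ Z0; have [lN NE] := ex _ N0.
have [lM ME] := ex _ M0; have [lk kE] := ex _ k0; have [ld dE] := ex _ d0.
have [lS SE] := ex _ S0; subst c Z N M k d S.
move: Mle Mge; rewrite -!expRN -!expRD -expRN -expRD !ler_expR => Mle Mge.
have p10 : 0 < p - 1 by lra.
have qE : q * (p - 1) = p by rewrite qdef mulfVK// gt_eqF.
have q1 : 1 < q by nra.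
have q2 : q < 2 by nra.
rewrite -!expRM -!expRM_natr -!expRN -!expRD -!expRN -!expRD.
pose u := lS + (1 - 2 / p) * lM + (2 / p - 1) * lN.
pose v := (1 - a) * lZ + (a + 1 - 2 / p) * lN - (1 - 2 / p) * lM.
have -> : lZ * (1 - a) + lS + lN * a = u + v by rewrite /u /v; ring.
rewrite expRD.
have p0 : p != 0 by rewrite gt_eqF//; lra.
have pq : p^-1 + q^-1 = 1.
  by rewrite qdef; field; rewrite p0 gt_eqF.
apply: le_trans (@conjugate_powR _ _ _ p q _ _ _ _ pq) _.
- exact: expR_ge0.
- exact: expR_ge0.
- lra.
- lra.
have dle (x y : R) : 0 <= x -> 1 <= y -> x / y <= x.
  by move=> x0 y1; rewrite ler_pdivrMr; [nra|lra].
rewrite -!expRM.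
apply: lerD; apply: le_trans (dle _ _ _ _) _; rewrite ?expR_ge0 ?ler_expR//.
- lra.
- have -> : u * p = lS * p + (p - 2) * lM + (2 - p) * lN by rewrite /u; field.
  nra.
- lra.
- have -> : v * q = q * (1 - a) * lZ + (q * a + 2 - q) * lN - (2 - q) * lM.
    by rewrite /v qdef; field; rewrite p0 gt_eqF.
  rewrite rE sE; nra.
Qed.

End exponents.

Section weighted_bound.
Context {R : realType} {n : nat} (B : bergman_space R n).
Local Notation sigma := (Defs.sigma B).
Local Notation K := (Defs.K B).
Local Notation phi := (Defs.phi B).
Local Notation k := (normalized_kernel sigma K).

Lemma young_pointwise_ereal (p q r s a c Z N M h d : R) (S : \bar R) :
  2 < p -> 0 < c -> 0 < Z -> 0 < N -> 0 < M -> 0 <= h -> 0 <= d -> (0 <= S)%E ->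
  M <= c * N * h -> M^-1 <= c * d / (Z * N) ->
  q = p / (p - 1) -> r = 2 - a * q -> s = a * q - 2 * q + 2 ->
  ((Z `^ (1 - a))%:E * (S * (N `^ a)%:E) <=
    (c `^ p)%:E * (S `^ p * (h `^ p / M ^+ 2)%:E * (N ^+ 2)%:E) +
    (c `^ (2 - q))%:E * (d `^ ((r + s) / 2) / (Z `^ s * N `^ r) * N ^+ 2)%:E)%E.
Proof.
move=> p2 c0 Z0 N0 M0 h0 d0 S0 Mle Mge qE rE sE.
have E0 : 0 <= d `^ ((r + s) / 2) / (Z `^ s * N `^ r) * N ^+ 2.
  by rewrite mulr_ge0 ?sqr_ge0// divr_ge0 ?mulr_ge0 ?powR_ge0.
have h1 : 0 < h.
  rewrite lt_neqAle h0 andbT eq_sym; apply/eqP => h00.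
  by move: Mle; rewrite h00 mulr0 leNgt M0.
case: S S0 => [x||//].
- rewrite lee_fin le_eqVlt => /predU1P[<-|x0].
    rewrite mul0e mule0 adde_ge0// mule_ge0 ?lee_fin ?powR_ge0//.
    by rewrite mulr_ge0 ?sqr_ge0// mulr_ge0 ?powR_ge0// divr_ge0 ?powR_ge0 ?sqr_ge0.
  rewrite poweR_EFin -!EFinM -EFinD lee_fin.
  have := @young_pointwise _ p q r s a c Z N M h d x p2 c0 Z0 N0 M0 h0 d0 x0
    Mle Mge qE rE sE.
  by rewrite !mulrA.
- move=> _; rewrite poweRyr; last by rewrite gt_eqF//; lra.
  have p0 : (0 < (h `^ p / M ^+ 2)%:E)%E.
    by rewrite lte_fin divr_gt0 ?powR_gt0 ?exprn_gt0.
  apply: (@le_trans _ _ +oo%E); first exact: leey.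
  rewrite [(+oo * (h `^ p / M ^+ 2)%:E)%E]gt0_mulye//.
  rewrite [(+oo * (N ^+ 2)%:E)%E]gt0_mulye ?lte_fin ?exprn_gt0//.
  rewrite gt0_muley ?lte_fin ?powR_gt0// addye ?leey//.
Qed.

Lemma kappa_bounds : 0 <= kappa B < 2.
Proof.
by case: (kappa_estimate B) => [[/andP[k0 k2] _]|[-> _]]; rewrite ?lexx ?ltr0n// k2 ltW.
Qed.

(** The row condition of the Schur test with weight ||K_w||^a.  Integrating
    [young_pointwise_ereal], the first term becomes the L^p norm of the
    translate of F by [lambda_change_of_variables], the second one is bounded by
    the kernel estimate; the factor ||K_z||^(1 - a) on the left makes both
    bounds uniform in z. *)
Lemma weighted_l1_bound (p : R) : (4 - kappa B) / (2 - kappa B) < p ->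
  exists a : R, forall M0 : R, exists2 C : R, 0 <= C &
  forall z (F : pt B -> nat -> R[i]), (forall j, cmeasurable (fun w => F w j)) ->
  (\int[sigma]_u ((l1norm (F (phi z u)) * (normc (k z u))%:E) `^ p) <= M0%:E ->
   (norm B z)%:E * \int[sigma]_w (l1norm (F w) * (norm B w `^ a)%:E) <=
   (C * norm B z `^ a)%:E)%E.
Proof.
move=> /(schur_exponent kappa_bounds)[p2 q1 q2 [a [ra [sa ka]]]].
exists a => M0.
set q := p / (p - 1) in q1 q2 ra sa ka.
pose r := 2 - a * q; pose s := a * q - 2 * q + 2.
have [C2 hC2] : kernel_estimate sigma K r s.
  case: (kappa_estimate B) => [[/andP[k0 k2]]|[k0]]; first by apply=> //; exact: sa.
  by rewrite /s -ka//; apply; rewrite -k0.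
have [c c0 hc] := K_norm_phi_bounds B.
have [L L0 hL] := lambda_change_of_variables B.
exists (c `^ p * (L * `|M0|) + c `^ (2 - q) * `|C2|).
  by rewrite addr_ge0// mulr_ge0 ?powR_ge0// mulr_ge0// ltW.
move=> z F mF hM0.
have Z0 := K_norm_gt0 z.
pose Z := norm B z.
(* E2 is the integrand of the kernel estimate, and H the p-th power of the
   translate of F divided by ||K||^2, so that H d lambda = |U_z F|^p d sigma. *)
pose E2 w := normc (scalar_dot sigma (K z) (K w)) `^ ((r + s) / 2) /
   (Z `^ s * norm B w `^ r) * norm B w ^+ 2.
have E20 w : 0 <= E2 w.
  by rewrite mulr_ge0 ?sqr_ge0// divr_ge0 ?mulr_ge0 ?powR_ge0.
pose H u : \bar R := (l1norm (F (phi z u)) `^ p * (normc (k z u) `^ p / norm B u ^+ 2)%:E)%E.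
have H0 u : (0 <= H u)%E.
  by rewrite mule_ge0 ?poweR_ge0// lee_fin divr_ge0 ?powR_ge0 ?sqr_ge0.
have mN : measurable_fun setT (fun u => norm B u) by exact: K_norm_measurable.
have mK : measurable_fun setT (fun u => normc (K z u)).
  exact: cmeasurable_normc (K_cmeasurable z).
have mk : measurable_fun setT (fun u => normc (k z u)).
  rewrite (_ : (fun u => _) = (fun u => normc (K z u) * (norm B z)^-1)).
    exact: measurable_funM.
  by apply/funext => u; rewrite normc_normalized_kernel.
have mpow (b : R) (f : pt B -> R) : measurable_fun setT f ->
    measurable_fun setT (fun u => f u `^ b).
  by move=> mf; exact: (measurableT_comp (measurable_powR b) mf).
have mS : measurable_fun setT (fun w => l1norm (F w)) by exact: measurable_l1norm.
have mSphi : measurable_fun setT (fun u => l1norm (F (phi z u))).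
  exact: (measurableT_comp mS (@phi_measurable _ _ B z)).
have mH : measurable_fun setT H.
  apply: emeasurable_funM.
    exact: (measurableT_comp (measurable_poweR p) mSphi).
  apply/measurable_EFinP; apply: measurable_funM; first exact: mpow.
  by apply: measurable_invr_ge0; [move=> u; exact: sqr_ge0|exact: measurable_funX].
have mE2 : measurable_fun setT E2.
  apply: measurable_funM; last exact: measurable_funX.
  apply: measurable_funM.
    by apply: mpow; under eq_fun do rewrite scalar_dot_K.
  apply: measurable_invr_ge0; first by move=> u; rewrite mulr_ge0 ?powR_ge0.
  by apply: measurable_funM => //; exact: mpow.
have mN2 : measurable_fun setT (fun w => (norm B w ^+ 2)%:E).
  by apply/measurable_EFinP; exact: measurable_funX.
have mHphi : measurable_fun setT (fun w => H (phi z w) * (norm B w ^+ 2)%:E)%E.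
  apply: emeasurable_funM; last exact: mN2.
  exact: (measurableT_comp mH (@phi_measurable _ _ B z)).
have main : ((Z `^ (1 - a))%:E * \int[sigma]_w (l1norm (F w) * (norm B w `^ a)%:E) <=
   (c `^ p * (L * `|M0|) + c `^ (2 - q) * `|C2|)%:E)%E.
  rewrite -ge0_integralZl//; first last.
  - by rewrite lee_fin powR_ge0.
  - by move=> w _; rewrite mule_ge0 ?l1norm_ge0 ?lee_fin ?powR_ge0.
  - by apply: emeasurable_funM => //; apply/measurable_EFinP; exact: mpow.
  apply: (@le_trans _ _ (\int[sigma]_w ((c `^ p)%:E * (H (phi z w) * (norm B w ^+ 2)%:E) +
     (c `^ (2 - q))%:E * (E2 w)%:E))%E).
    apply: ge0_le_integral => //.
    - by move=> w _; rewrite !mule_ge0 ?l1norm_ge0 ?lee_fin ?powR_ge0.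
    - apply: measurable_funeM.
      by apply: emeasurable_funM => //; apply/measurable_EFinP; exact: mpow.
    - apply: emeasurable_funD; apply: measurable_funeM; last exact/measurable_EFinP.
      exact: mHphi.
    - move=> w _; rewrite /H phi_involution /E2 scalar_dot_K.
      have [h1 h2] := hc z w.
      apply: young_pointwise_ereal => //; try exact: K_norm_gt0; try exact: normc_ge0.
      exact: l1norm_ge0.
  rewrite ge0_integralD//; first last.
  - by apply: measurable_funeM; exact/measurable_EFinP.
  - by move=> w _; rewrite mule_ge0 ?lee_fin ?powR_ge0.
  - by apply: measurable_funeM; exact: mHphi.
  - move=> w _; apply: mule_ge0; first by rewrite lee_fin powR_ge0.
    by apply: mule_ge0; [exact: H0|rewrite lee_fin sqr_ge0].
  rewrite !ge0_integralZl//; first last.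
  - by rewrite lee_fin powR_ge0.
  - by move=> w _; rewrite mule_ge0 ?lee_fin ?sqr_ge0.
  - by rewrite lee_fin powR_ge0.
  - by move=> w _; rewrite lee_fin.
  - exact/measurable_EFinP.
  rewrite EFinD !EFinM; apply: leeD; apply: lee_wpmul2l; rewrite ?lee_fin ?powR_ge0//.
    apply: le_trans (hL z H mH H0) _; apply: lee_wpmul2l; first by rewrite lee_fin ltW.
    apply: (@le_trans _ _ M0%:E); last by rewrite lee_fin ler_norm.
    apply: le_trans hM0; rewrite le_eqVlt; apply/orP; left; apply/eqP.
    apply: eq_integral => u _; rewrite /H -muleA -EFinM.
    rewrite divfK ?gt_eqF ?exprn_gt0 ?K_norm_gt0//.
    by rewrite poweRM ?l1norm_ge0 ?lee_fin ?normc_ge0.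
  apply: le_trans (hC2 z) _; rewrite lee_fin; exact: ler_norm.
have ZE : norm B z = Z `^ a * Z `^ (1 - a).
  by rewrite -powRD ?subrKC ?powRr1 ?K_norm_ge0// gt_eqF ?implybT.
rewrite {1}ZE EFinM -muleA -/Z [leRHS]EFinM [leRHS]muleC.
by apply: lee_wpmul2l; rewrite ?lee_fin ?powR_ge0.
Qed.

End weighted_bound.

(** * Projection and extension in a Hilbert seminorm *)

Section hilbert.
Context {R : realType} {V : lmodType R[i]}.
Variables (A W : set V) (N : V -> R).
Hypothesis A_lin : forall a x y, A x -> A y -> A (a *: x + y).
Hypothesis W_lin : forall a x y, W x -> W y -> W (a *: x + y).
Hypothesis W0 : W 0.
Hypothesis WA : W `<=` A.
Hypothesis N_ge0 : forall x, 0 <= N x.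
Hypothesis NZ : forall a x, A x -> N (a *: x) = normc a * N x.
Hypothesis N_parallelogram : forall t x y, 0 < t -> A x -> A y ->
  N (x + y) ^+ 2 + t^-1 * N (t%:C *: x - y) ^+ 2 =
  (1 + t) * N x ^+ 2 + (1 + t^-1) * N y ^+ 2.

Let A0 : A 0. Proof. exact: WA. Qed.

Let AZ a x : A x -> A (a *: x).
Proof. by move=> Ax; rewrite -[_ *: _]addr0; exact: A_lin. Qed.

Let AD x y : A x -> A y -> A (x + y).
Proof. by move=> Ax Ay; rewrite -[x]scale1r; exact: A_lin. Qed.

Let AN x : A x -> A (- x).
Proof. by move=> Ax; rewrite -scaleN1r; exact: AZ. Qed.

Let AB x y : A x -> A y -> A (x - y).
Proof. by move=> Ax Ay; exact/AD/AN. Qed.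

Let WZ a x : W x -> W (a *: x).
Proof. by move=> Wx; rewrite -[_ *: _]addr0; exact: W_lin. Qed.

Let WD x y : W x -> W y -> W (x + y).
Proof. by move=> Wx Wy; rewrite -[x]scale1r; exact: W_lin. Qed.

Let WB x y : W x -> W y -> W (x - y).
Proof. by move=> Wx Wy; apply: WD => //; rewrite -scaleN1r; exact: WZ. Qed.

Lemma seminorm0 : N 0 = 0.
Proof. by rewrite -(scale0r 0) NZ// normc_zero mul0r. Qed.

Lemma seminormN x : A x -> N (- x) = N x.
Proof.
move=> Ax; rewrite -scaleN1r NZ//.
by rewrite normcN normc_one mul1r.
Qed.

Lemma seminormC x y : A x -> A y -> N (x - y) = N (y - x).
Proof. by move=> Ax Ay; rewrite -(seminormN (AB Ax Ay)) opprB. Qed.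

(** Optimizing t in the weighted parallelogram law means t = N y / N x; adding
    e / 2 to both norms avoids dividing by zero. *)
Lemma seminorm_triangle x y : A x -> A y -> N (x + y) <= N x + N y.
Proof.
move=> Ax Ay; apply/ler_addgt0Pr => e e0.
have e2 : 0 < e / 2 by rewrite divr_gt0.
pose a := N x + e / 2; pose b := N y + e / 2.
have a0 : 0 < a by rewrite ltr_wpDl.
have b0 : 0 < b by rewrite ltr_wpDl.
have -> : N x + N y + e = a + b by rewrite /a /b; field.
have xa : N x <= a by rewrite lerDl ltW.
have yb : N y <= b by rewrite lerDl ltW.
clearbody a b.
have [a0' b0'] := (ltW a0, ltW b0).
have h := N_parallelogram (divr_gt0 b0 a0) Ax Ay.
rewrite -(ler_pXn2r (n := 2))// ?nnegrE ?addr_ge0//.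
apply: (@le_trans _ _ ((1 + b / a) * N x ^+ 2 + (1 + (b / a)^-1) * N y ^+ 2)).
  by rewrite -h lerDl mulr_ge0 ?sqr_ge0// invr_ge0 divr_ge0.
have -> : (a + b) ^+ 2 = (1 + b / a) * a ^+ 2 + (1 + (b / a)^-1) * b ^+ 2.
  by field; rewrite !gt_eqF.
apply: lerD; apply: ler_wpM2l; rewrite ?addr_ge0 ?invr_ge0 ?divr_ge0//.
  by rewrite ler_pXn2r ?nnegrE.
by rewrite ler_pXn2r ?nnegrE.
Qed.

Lemma seminorm_triangleB x y z : A x -> A y -> A z -> N (x - z) <= N (x - y) + N (y - z).
Proof.
move=> Ax Ay Az; rewrite -[x - z](subrKA y).
by rewrite seminorm_triangle//; exact: AB.
Qed.

Hypothesis A_complete : complete_for A N.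

Let harmonic (e : R) : 0 < e -> exists m : nat, m.+1%:R^-1 < e.
Proof.
move=> e0; have [m _ /(_ m (leqnn m))] := near_infty_natSinv_lt (PosNum e0).
by exists m.
Qed.

Let harmonic_le (m k : nat) : (m <= k)%N -> k.+1%:R^-1 <= m.+1%:R^-1 :> R.
Proof. by move=> mk; rewrite lef_pV2 ?posrE// ler_nat. Qed.

(** The projection theorem in a form that does not name the projection: g is
    the component of x orthogonal to W, expressed by minimality.  The
    parallelogram law makes a minimizing sequence x - f_n Cauchy; its limit is
    g. *)
Lemma orthogonal_residue x : A x -> exists2 g, A g &
  (forall e, 0 < e -> exists2 f, W f & N (x - f - g) < e) /\
  (forall f, W f -> N g <= N (g + f)).
Proof.
move=> Ax.
pose E := [set N (x - f) | f in W].
have E_inf : has_inf E.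
  split; first by exists (N (x - 0)), 0.
  by exists 0 => _ [f _ <-].
pose d := inf E.
have d_le f : W f -> d <= N (x - f).
  by move=> Wf; apply: ge_inf; [case: E_inf|exists f].
have d0 : 0 <= d by apply: lb_le_inf; [case: E_inf|move=> _ [f _ <-]].
have ex (n : nat) : {f | W f /\ N (x - f) < d + n.+1%:R^-1}.
  apply: cid; have n0 : 0 < (n.+1%:R^-1 : R) by rewrite invr_gt0.
  by have [_ [f Wf <-] lt] := inf_adherent n0 E_inf; exists f.
pose f n := sval (ex n); pose u n := x - f n.
have Wf n : W (f n) by case: (svalP (ex n)).
have uf n : N (u n) < d + n.+1%:R^-1 by case: (svalP (ex n)).
have Au n : A (u n) by apply: AB => //; exact: WA.
have u_cauchy e : 0 < e -> exists M, forall i j, (M <= i)%N -> (M <= j)%N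
  -> N (u i - u j) < e.
  move=> e0.
  have [m hm] : exists m : nat, (m.+1%:R^-1 : R) < e ^+ 2 / (8 * d + 4).
    by apply: harmonic; rewrite divr_gt0 ?exprn_gt0//; lra.
  exists m => i j mi mj.
  rewrite -(ltr_pXn2r (n := 2))// ?nnegrE ?(ltW e0)//.
  have par : N (u i + u j) ^+ 2 + N (u i - u j) ^+ 2 = 2 * N (u i) ^+ 2 + 2 * N (u j) ^+ 2.
    by have := N_parallelogram (@ltr01 R) (Au i) (Au j); rewrite invr1 mul1r scale1r.
  (* u_i + u_j is twice the difference of x and the midpoint of f_i, f_j. *)
  have two : 2 * d <= N (u i + u j).
    have -> : u i + u j = (2 : R)%:C *: (x - (2^-1 : R)%:C *: (f i + f j)).
      rewrite scalerBr scalerA -rmorphM/= divff// scale1r.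
      rewrite (_ : (2 : R)%:C = 1 + 1) ?scalerDl ?scale1r; last by rewrite rmorphD.
      by rewrite /u opprD addrACA.
    rewrite NZ; last by apply: AB => //; apply/WA/WZ/WD.
    rewrite /= expr0n addr0 sqrtr_sqr ger0_norm// ler_pM2l//.
    by apply: d_le; apply: WZ; exact: WD.
  have := uf i; have := uf j; have := harmonic_le mi; have := harmonic_le mj.
  have := N_ge0 (u i); have := N_ge0 (u j).
  have t0 : 0 < (m.+1%:R^-1 : R) by rewrite invr_gt0.
  have t1 : (m.+1%:R^-1 : R) <= 1 by rewrite invf_le1 ?ler1n.
  rewrite ltr_pdivlMr in hm; last by lra.
  move: (m.+1%:R^-1) (i.+1%:R^-1) (j.+1%:R^-1) hm t0 t1 => t ti tj
    hm t0 t1 uj ui tij tii Nj Ni.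
  have s1 : N (u i) ^+ 2 <= (d + t) ^+ 2 by rewrite ler_pXn2r ?nnegrE//; lra.
  have s2 : N (u j) ^+ 2 <= (d + t) ^+ 2 by rewrite ler_pXn2r ?nnegrE//; lra.
  have s3 : (2 * d) ^+ 2 <= N (u i + u j) ^+ 2 by rewrite ler_pXn2r ?nnegrE//; lra.
  nra.
have [g Ag /cvgrPdist_lt gu] := A_complete Au u_cauchy.
have near_g e : 0 < e -> exists n, N (u n - g) < e /\ (n.+1%:R^-1 : R) < e.
  move=> e0; have [m hm] := harmonic e0.
  have [k _ hk] := gu _ e0; exists (maxn m k); split.
    have := hk (maxn m k) (leq_maxr _ _).
    by rewrite /= sub0r normrN ger0_norm.
  exact: le_lt_trans (harmonic_le (leq_maxl _ _)) hm.
exists g => //; split.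
  by move=> e e0; have [k [hk _]] := near_g _ e0; exists (f k).
move=> h Wh; apply/ler_addgt0Pr => e e0.
have e3 : 0 < e / 3 by rewrite divr_gt0.
have [k [ng nk]] := near_g _ e3.
have h1 : N g <= N (g - u k) + N (u k).
  by rewrite -[X in N X <= _](subrK (u k)) seminorm_triangle//; exact: AB.
have h2 : N (u k + h) <= N (u k - g) + N (g + h).
  rewrite (_ : u k + h = (u k - g) + (g + h)); last by rewrite addrA subrK.
  by apply: seminorm_triangle; [exact: AB|apply: AD => //; exact: WA].
have h3 : d <= N (u k + h).
  rewrite (_ : u k + h = x - (f k - h)); last by rewrite /u opprB addrAC addrA.
  by apply: d_le; exact: WB.
have h4 : N (g - u k) = N (u k - g) by exact: seminormC.
have h5 := uf k; rewrite h4 in h1.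
move: h1 h2 h3 h5 ng nk; move: (N (u k)) (N (u k + h)) (N (u k - g)) (N g) (N (g
  + h)) (k.+1%:R^-1).
move=> *; lra.
Qed.

Section extension.
Variables (T : V -> V) (C : R).
Hypothesis TA : forall f, W f -> A (T f).
Hypothesis T_lin : forall a f g, W f -> W g -> T (a *: f + g) = a *: T f + T g.
Hypothesis T_bound : forall f, W f -> N (T f) <= C * N f.
Hypothesis W_dense : forall x e, A x -> 0 < e -> exists2 f, W f & N (x - f) < e.
Hypothesis N_definite : forall x, A x -> N x = 0 -> x = 0.

Let TB f g : W f -> W g -> T (f - g) = T f - T g.
Proof.
move=> Wf Wg; rewrite addrC -scaleN1r T_lin// scaleN1r addrC//.
Qed.

Let C0 : exists2 C', 0 < C' & forall f, W f -> N (T f) <= C' * N f.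
Proof.
exists (`|C| + 1); first by rewrite ltr_wpDl.
move=> f Wf; apply: le_trans (T_bound Wf) _; apply: ler_wpM2r => //.
by apply: le_trans (ler_norm _) _; rewrite lerDl.
Qed.

(** The graph of the extension of T by continuity.  Working with the graph makes
    linearity and boundedness consequences of approximation, independent of the
    chosen sequences. *)
Definition limit_pair x y := A y /\ forall e, 0 < e ->
  exists f, [/\ W f, N (x - f) < e & N (y - T f) < e].

Lemma limit_pair_ex x : A x -> exists y, limit_pair x y.
Proof.
move=> Ax; have [C' C'0 TC'] := C0.
have ex (n : nat) : {f | W f /\ N (x - f) < n.+1%:R^-1}.
  apply: cid; have n0 : 0 < (n.+1%:R^-1 : R) by rewrite invr_gt0.
  by have [f Wf lt] := W_dense Ax n0; exists f.
pose f n := sval (ex n).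
have Wf n : W (f n) by case: (svalP (ex n)).
have xf n : N (x - f n) < n.+1%:R^-1 by case: (svalP (ex n)).
have [||y Ay /cvgrPdist_lt yT] := @A_complete (fun n => T (f n)).
- by move=> n; exact: TA.
- move=> e e0; have [m hm] : exists m : nat, (m.+1%:R^-1 : R) < e / (2 * C').
    by apply: harmonic; rewrite divr_gt0// mulr_gt0.
  exists m => i j mi mj; rewrite -TB//.
  apply: le_lt_trans (TC' _ (WB (Wf i) (Wf j))) _.
  rewrite ltr_pdivlMr ?mulr_gt0// in hm.
  have h1 : N (f i - f j) <= N (f i - x) + N (x - f j).
    by apply: seminorm_triangleB => //; exact: WA.
  have h2 : N (f i - x) = N (x - f i) by apply: seminormC => //; exact: WA.
  have := harmonic_le mi; have := harmonic_le mj; have := xf i; have := xf j.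
  rewrite h2 in h1; move: h1 hm.
  move: (m.+1%:R^-1) (i.+1%:R^-1) (j.+1%:R^-1) (N (x - f i)) (N (x - f j)) (N (f i - f j)).
  by move=> t ti tj a b c *; nra.
- exists y; split=> // e e0.
  have [m hm] := harmonic e0; have [k _ hk] := yT _ e0.
  exists (f (maxn m k)); split => //.
    by apply: lt_trans (xf _) _; apply: le_lt_trans (harmonic_le (leq_maxl _ _)) hm.
  have := hk (maxn m k) (leq_maxr _ _); rewrite /= sub0r normrN ger0_norm//.
  by rewrite seminormC//; exact: TA.
Qed.

Lemma limit_pair_lin a x y x' y' : A x -> A x' -> limit_pair x y -> limit_pair x' y' ->
  limit_pair (a *: x + x') (a *: y + y').
Proof.
move=> Ax Ax' [Ay H] [Ay' H']; split; first exact: A_lin.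
move=> e e0; pose c := normc a + 1.
have c0 : 0 < c by rewrite ltr_wpDl// ?sqrtr_ge0//; case: (a) => ? ?; exact: sqrtr_ge0.
have ec : 0 < e / (2 * c) by rewrite divr_gt0// mulr_gt0.
have e2 : 0 < e / 2 by rewrite divr_gt0.
have [f [Wf xf yf]] := H _ ec; have [f' [Wf' xf' yf']] := H' _ e2.
have half r : 0 <= r -> r < e / (2 * c) -> normc a * r < e / 2.
  move=> r0; rewrite ltr_pdivlMr ?mulr_gt0// => h.
  rewrite ltr_pdivlMr//; apply: le_lt_trans h.
  rewrite /c; nra.
exists (a *: f + f'); split; first exact: W_lin.
  rewrite (_ : _ - _ = a *: (x - f) + (x' - f')); last first.
    by rewrite scalerBr opprD addrACA.
  apply: le_lt_trans (seminorm_triangle _ _) _.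
  - by apply: AZ; apply: AB => //; exact: WA.
  - by apply: AB => //; exact: WA.
  rewrite NZ; last by apply: AB => //; exact: WA.
  by rewrite [ltRHS](splitr e) ltrD// half.
rewrite T_lin// (_ : _ - _ = a *: (y - T f) + (y' - T f')); last first.
  by rewrite scalerBr opprD addrACA.
apply: le_lt_trans (seminorm_triangle _ _) _.
- by apply: AZ; apply: AB => //; exact: TA.
- by apply: AB => //; exact: TA.
rewrite NZ; last by apply: AB => //; exact: TA.
by rewrite [ltRHS](splitr e) ltrD// half.
Qed.

Lemma limit_pair_bound x y : A x -> limit_pair x y -> N y <= (`|C| + 1) * N x.
Proof.
move=> Ax [Ay H]; apply/ler_addgt0Pr => e e0.
pose C' := `|C| + 1.
have C'0 : 0 < C' by rewrite ltr_wpDl.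
have TC' f : W f -> N (T f) <= C' * N f.
  move=> Wf; apply: le_trans (T_bound Wf) _; apply: ler_wpM2r => //.
  by apply: le_trans (ler_norm _) _; rewrite lerDl.
have ec : 0 < e / (1 + C') by rewrite divr_gt0// addr_gt0.
have [f [Wf xf yf]] := H _ ec.
have h1 : N y <= N (y - T f) + N (T f).
  by rewrite -[X in N X <= _](subrK (T f)) seminorm_triangle//;
    [exact: AB (TA _)|exact: TA].
have h2 : N f <= N (f - x) + N x.
  by rewrite -[X in N X <= _](subrK x) seminorm_triangle//; apply: AB => //; exact: WA.
have h3 : N (f - x) = N (x - f) by apply: seminormC => //; exact: WA.
have h4 := TC' _ Wf.
rewrite -/C'.
have h5 : e = e / (1 + C') + C' * (e / (1 + C')) by field; rewrite gt_eqF// addr_gt0.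
rewrite h5.
have : C' * N f <= C' * (e / (1 + C') + N x) by rewrite ler_pM2l//; lra.
rewrite mulrDr; lra.
Qed.

(** The difference of two values at x is a value at 0, which the bound forces
    to have norm 0. *)
Lemma limit_pair_unique x y y' : A x -> limit_pair x y -> limit_pair x y' -> y = y'.
Proof.
move=> Ax Ly Ly'; have Ay := Ly.1; have Ay' := Ly'.1.
have L := limit_pair_lin (-1) Ax Ax Ly Ly'.
have := limit_pair_bound (AD (AZ (-1) Ax) Ax) L.
rewrite !scaleN1r addNr seminorm0 mulr0 => h.
have e0 : - y + y' = 0.
  apply: N_definite; first by apply: AD => //; exact: AN.
  by apply: le_anti; rewrite h N_ge0.
by apply/eqP; rewrite eq_sym -subr_eq0 addrC e0.
Qed.

Lemma bounded_extension : exists S : V -> V,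
  [/\ forall x, A x -> A (S x),
      forall a x y, A x -> A y -> S (a *: x + y) = a *: S x + S y,
      forall x, A x -> N (S x) <= (`|C| + 1) * N x &
      forall f, W f -> S f = T f].
Proof.
pose S x := xget 0 [set y | limit_pair x y].
have LS x : A x -> limit_pair x (S x).
  move=> /limit_pair_ex [y Ly]; rewrite /S.
  by case: xgetP => [z _ //|/(_ y)].
exists S; split.
- by move=> x /LS[].
- move=> a x y Ax Ay; apply: (@limit_pair_unique (a *: x + y)).
  + exact: A_lin.
  + by apply: LS; exact: A_lin.
  + by apply: limit_pair_lin => //; exact: LS.
- by move=> x Ax; apply: limit_pair_bound => //; exact: LS.
- move=> f Wf; apply: (@limit_pair_unique f); [exact: WA|by apply: LS; exact: WA|].
  split; first exact: TA.
  by move=> e e0; exists f; rewrite !subrr seminorm0.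
Qed.

End extension.
End hilbert.

(** * The span of the kernels *)

Section kernel_span_lemmas.
Context {R : realType} {n : nat} (B : bergman_space R n).
Local Notation sigma := (Defs.sigma B).
Local Notation K := (Defs.K B).
Local Notation k := (normalized_kernel sigma K).
Local Notation kv z i := (kernel_vector z (l2basis i) : pt B -> nat -> R[i]).
Implicit Types F G : pt B -> nat -> R[i].

Lemma scalar_bergmanZ (a : R[i]) f : scalar_bergman sigma f ->
  scalar_bergman sigma (fun w => a * f w).
Proof.
move=> [af ef]; split.
  have := analytic_lin a af (analytic_cst 0).
  by rewrite (_ : (fun w => _ + _) = fun w => a * f w)//; apply/funext => w; rewrite addr0.
under eq_integral do rewrite Normc.normcM exprMn EFinM.
rewrite ge0_integralZl//.
- by rewrite lte_mul_pinfty// lee_fin sqr_ge0.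
- apply/measurable_EFinP; apply: measurable_funX; apply: cmeasurable_normc.
  exact: (analytic_measurable af).
- by move=> w _; rewrite lee_fin sqr_ge0.
- by rewrite lee_fin sqr_ge0.
Qed.

Lemma normalized_kernel_bergman z : scalar_bergman sigma (k z).
Proof.
rewrite (_ : k z = fun w => (norm B z)%:C^-1 * K z w).
  by apply: scalar_bergmanZ; exact: K_bergman.
by apply/funext => w; rewrite /normalized_kernel mulrC.
Qed.

Lemma normalized_kernel_cmeasurable z : cmeasurable (k z).
Proof. exact: scalar_cmeasurable (normalized_kernel_bergman z). Qed.

Lemma kvE z i w j : kv z i w j = if j == i then k z w else 0.
Proof. by rewrite /kernel_vector /l2basis; case: eqP; rewrite ?mulr1 ?mulr0. Qed.

Lemma l2sqnorm_single (c : R[i]) i :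
  l2sqnorm (fun j => if j == i then c else 0) = (normc c ^+ 2)%:E.
Proof.
rewrite /l2sqnorm (nneseriesD1 (n := i))//; last by move=> *; rewrite lee_fin sqr_ge0.
rewrite eqxx eseries0 ?adde0// => j _ /= /negbTE ->.
by rewrite normc_zero expr0n.
Qed.

Lemma kv_bergman z i : bergman sigma (kv z i).
Proof.
have kvw w : kv z i w = fun j => if j == i then k z w else 0.
  by apply/funext => j; rewrite kvE.
have [ak ek] := normalized_kernel_bergman z.
split.
- by move=> w; rewrite /in_l2 kvw l2sqnorm_single ltry.
- move=> j; under eq_fun do rewrite kvE.
  by case: eqP => // _; exact: analytic_cst.
- by under eq_integral do rewrite kvw l2sqnorm_single.
Qed.

Lemma finite_vector_l2basis i : finite_vector (l2basis i : nat -> R[i]).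
Proof.
apply: (@sub_finite_set _ _ [set i]) => // j /=.
by rewrite /l2basis; case: (j =P i) => // _; rewrite mulr0n eqxx.
Qed.

Lemma kv_span z e : finite_vector e -> kernel_span B (kernel_vector z e).
Proof.
move=> fe; exists 1%N, (fun=> z), (fun=> e); split=> //.
by apply/funext => w; apply/funext => j; rewrite big_ord1.
Qed.

Lemma kernel_span_lin a F G : kernel_span B F -> kernel_span B G ->
  kernel_span B (fun w j => a * F w j + G w j).
Proof.
move=> [m1 [z1 [h1 [f1 ->]]]] [m2 [z2 [h2 [f2 ->]]]].
exists (m1 + m2)%N, (fun i : 'I_(m1 + m2) => match fintype.split i with inl j => z1 j |
  inr j => z2 j end),
  (fun i : 'I_(m1 + m2) => match fintype.split i with inl j => (fun l => a * h1 j l) |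
    inr j => h2 j end).
split.
  move=> i; case: (fintype.split i) => j //.
  by apply: sub_finite_set (f1 j) => l /=; apply: contra_neq => ->; rewrite mulr0.
apply/funext => w; apply/funext => j; rewrite big_split_ord mulr_sumr; congr (_ + _).
  apply: eq_bigr => i _; rewrite (unsplitK (inl i)) /kernel_vector.
  by rewrite mulrCA.
by apply: eq_bigr => i _; rewrite (unsplitK (inr i)).
Qed.

Lemma kernel_span0 : kernel_span B (fun _ _ => 0).
Proof.
exists 0%N, (fun=> origin B), (fun=> l2basis 0); split; first by case.
by apply/funext => w; apply/funext => j; rewrite big_ord0.
Qed.

Lemma finite_vector_bound (h : nat -> R[i]) : finite_vector h ->
  exists J, forall j, (J <= j)%N -> h j = 0.
Proof.
move=> /finite_seqP[s hs]; exists (\max_(i <- s) i).+1 => j Jj.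
apply/eqP; apply: contraT => hj.
have : [set j | h j != 0] j by [].
rewrite hs /= => js.
by have := @leq_bigmax_seq _ s xpredT id j js isT; rewrite leqNgt Jj.
Qed.

(** The span consists of the linear combinations of the k_z e_i, since finite
    vectors are combinations of basis vectors. *)
Lemma kernel_span_ind (P : (pt B -> nat -> R[i]) -> Prop) :
  P (fun _ _ => 0) -> (forall z i, P (kv z i)) ->
  (forall a F G, kernel_span B F -> kernel_span B G -> P F -> P G ->
     P (fun w j => a * F w j + G w j)) ->
  forall F, kernel_span B F -> P F.
Proof.
move=> P0 Pkv Plin.
have Pvec J z h : (forall j, (J <= j)%N -> h j = 0)
  -> kernel_span B (kernel_vector z h) /\ P (kernel_vector z h).
  elim: J h => [h h0|J IH h hJ].
    rewrite (_ : kernel_vector z h = fun _ _ => 0).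
      by split => //; exact: kernel_span0.
    by apply/funext => w; apply/funext => j; rewrite /kernel_vector h0// mulr0.
  pose h' j := if j == J then 0 else h j.
  have [|S' P'] := IH h'.
    move=> j; rewrite /h' leq_eqVlt eq_sym => /orP[/eqP ->|Jj]; first by rewrite eqxx.
    by case: eqP => // _; exact: hJ.
  have -> : kernel_vector z h = fun w j => h J * kv z J w j + kernel_vector z h' w j.
    apply/funext => w; apply/funext => j; rewrite kvE /kernel_vector /h'.
    by case: eqP => [->|_]; rewrite ?mulr0 ?addr0 ?add0r// mulrC.
  have SJ := kv_span z (finite_vector_l2basis J).
  by split; [exact: kernel_span_lin|exact: Plin].
move=> F [m [z [h [fh ->]]]].
suff [] : kernel_span B (fun w j => \sum_(i < m) kernel_vector (z i) (h i) w j) /\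
   P (fun w j => \sum_(i < m) kernel_vector (z i) (h i) w j) by [].
elim: m z h fh => [|m IH] z h fh.
  rewrite (_ : (fun w j => _) = fun _ _ => 0).
    by split => //; exact: kernel_span0.
  by apply/funext => w; apply/funext => j; rewrite big_ord0.
have [J hJ] := finite_vector_bound (fh ord0).
have [S1 P1] := Pvec J (z ord0) _ hJ.
have [S2 P2] := IH (fun i => z (lift ord0 i)) (fun i => h (lift ord0 i)) (fun i
  => fh (lift ord0 i)).
rewrite (_ : (fun w j => _) = (fun w j => 1 * kernel_vector (z ord0) (h ord0) w j +
   (fun w j => \sum_(i < m) kernel_vector (z (lift ord0 i)) (h (lift ord0 i)) w j) w j)).
  by split; [exact: kernel_span_lin|exact: Plin].
by apply/funext => w; apply/funext => j; rewrite big_ord_recl mul1r.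
Qed.

Lemma bergman_lin a F G : bergman sigma F -> bergman sigma G ->
  bergman sigma (fun w j => a * F w j + G w j).
Proof. by move=> bF bG; exact: (bergman_add (bergmanZ a bF) bG). Qed.

Lemma kernel_span_bergman F : kernel_span B F -> bergman sigma F.
Proof.
apply: kernel_span_ind => [|z i|a G H _ _]; [|exact: kv_bergman|exact: bergman_lin].
have := bergmanZ 0 (kv_bergman (origin B) 0).
by rewrite (_ : (fun w j => _) = fun _ _ => 0)//; apply/funext => w; apply/funext => j;
  rewrite mul0r.
Qed.

Lemma dot_kv_integrable F z i : bergman sigma F ->
  cintegrable sigma (fun w => F w i * (k z w)^*).
Proof.
move=> bF; have [_ ek] := normalized_kernel_bergman z.
apply: cintegrable_mul.
- exact: bergman_cmeasurable bF.
- exact/cmeasurableJ/normalized_kernel_cmeasurable.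
- by have [] := bergman_coord i bF.
- by under eq_integral do rewrite normcJ.
Qed.

Lemma dot_kvr F z i : bergman_dot sigma F (kv z i) =
  complex_integral sigma (fun w => F w i * (k z w)^*).
Proof.
rewrite /bergman_dot; congr complex_integral; apply/funext => w.
rewrite (@l2dot_single _ _ _ i) ?kvE ?eqxx// => j /negbTE ji.
by rewrite kvE ji rmorph0 mulr0.
Qed.

Lemma dot_kvl F z i : bergman_dot sigma (kv z i) F =
  complex_integral sigma (fun w => k z w * (F w i)^*).
Proof.
rewrite /bergman_dot; congr complex_integral; apply/funext => w.
rewrite (@l2dot_single _ _ _ i) ?kvE ?eqxx// => j /negbTE ji.
by rewrite kvE ji mul0r.
Qed.

(** The reproducing property, read as a pairing with k_z e_i; it turns the
    adjoint relation into an identity between values of functions. *)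
Lemma reproducing_dot F z i : bergman sigma F ->
  F z i = (norm B z)%:C * bergman_dot sigma F (kv z i).
Proof.
move=> bF; rewrite dot_kvr -complex_integralZ; last exact: dot_kv_integrable.
rewrite (K_reproducing z i bF); congr complex_integral; apply/funext => w.
rewrite /normalized_kernel conjc_divr.
have Nz : (norm B z)%:C != 0 :> R[i].
  by rewrite (inj_eq (@complexI R)) gt_eqF ?K_norm_gt0.
by rewrite mulrC mulrCA [_ * (_ / _)]mulrC divfK.
Qed.

Lemma dot_kvC F z i : bergman sigma F ->
  bergman_dot sigma (kv z i) F = (bergman_dot sigma F (kv z i))^*.
Proof.
move=> bF; rewrite dot_kvl dot_kvr -complex_integralJ; last exact: dot_kv_integrable.
congr complex_integral; apply/funext => w.
by rewrite rmorphM/= conjcK mulrC.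
Qed.

End kernel_span_lemmas.

Section density.
Context {R : realType} {n : nat} (B : bergman_space R n).
Local Notation sigma := (Defs.sigma B).
Local Notation K := (Defs.K B).
Local Notation k := (normalized_kernel sigma K).
Local Notation kv z i := (kernel_vector z (l2basis i) : pt B -> nat -> R[i]).
Implicit Types F G : pt B -> nat -> R[i].

Definition sqint (f : pt B -> R[i]) : R := (\int[sigma]_w (normc (f w) ^+ 2))%R.

Lemma scalar_sq_integrable f : scalar_bergman sigma f ->
  sigma.-integrable setT (EFin \o (fun w => normc (f w) ^+ 2)).
Proof.
move=> sf; have [af ef] := sf; apply/integrableP; split.
  exact/measurable_EFinP/measurable_funX/cmeasurable_normc/scalar_cmeasurable.
by under eq_integral do rewrite /= ger0_norm ?sqr_ge0//.
Qed.

Lemma sqint_fin f : scalar_bergman sigma f ->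
  (\int[sigma]_w (normc (f w) ^+ 2)%:E)%E = (sqint f)%:E.
Proof.
move=> sf; rewrite /sqint /Rintegral fineK//.
exact: (integrable_fin_num _ (scalar_sq_integrable sf)).
Qed.

(** The first variation of the squared L^2 norm. *)
Lemma sqint_add f g c : scalar_bergman sigma f -> scalar_bergman sigma g ->
  sqint (fun w => f w + c * g w) = sqint f +
    2 * complex.Re (c^* * complex_integral sigma (fun w => f w * (g w)^*)) +
    normc c ^+ 2 * sqint g.
Proof.
move=> sf sg.
have If := scalar_sq_integrable sf; have Ig := scalar_sq_integrable sg.
have cI : cintegrable sigma (fun w => f w * (g w)^*).
  apply: cintegrable_mul; first exact: scalar_cmeasurable.
  - exact/cmeasurableJ/scalar_cmeasurable.
  - by have [] := sf.
  - by under eq_integral do rewrite normcJ; have [] := sg.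
rewrite -complex_integralZ//.
have IRe := cintegrable_Re (cintegrableZ (c^*) cI).
have IZ (r : R) (h : pt B -> R) : sigma.-integrable setT (EFin \o h) ->
    sigma.-integrable setT (EFin \o (fun x => r * h x)).
  move=> Ih; rewrite (_ : _ \o _ = fun x => r%:E * (EFin \o h) x)%E.
    exact: integrableZl.
  by apply/funext => x /=; rewrite EFinM.
have ID (h1 h2 : pt B -> R) : sigma.-integrable setT (EFin \o h1) ->
    sigma.-integrable setT (EFin \o h2) ->
    sigma.-integrable setT (EFin \o (fun x => h1 x + h2 x)).
  move=> I1 I2; rewrite (_ : _ \o _ = (EFin \o h1) \+ (EFin \o h2))%E//.
  exact: integrableD.
have I2 := IZ 2 _ IRe; have I3 := IZ (normc c ^+ 2) _ Ig.
rewrite /sqint /= -(RintegralZl _ measurableT IRe)// -(RintegralZl _ measurableT Ig)//.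
rewrite -(RintegralD measurableT If I2)// -(RintegralD measurableT (ID _ _ If I2) I3)//.
by apply: eq_Rintegral => w _; rewrite sqr_normcDM.
Qed.

(** A multiple of k_z e_i changes only the i-th coordinate, so the energies
    differ by a scalar quantity.  Stated without subtraction because the values
    are extended reals. *)
Lemma energy_add_kv F z i c : bergman sigma F ->
  (energy sigma (fun w j => F w j + c * kv z i w j)%R + (sqint (fun w => F w i))%:E =
   energy sigma F + (sqint (fun w => F w i + c * k z w)%R)%:E)%E.
Proof.
move=> bF.
have bG : bergman sigma (fun w j => F w j + c * kv z i w j).
  rewrite (_ : (fun w j => _) = (fun w j => c * kv z i w j + F w j)).
    by apply: bergman_lin => //; exact: kv_bergman.
  by apply/funext => w; apply/funext => j; rewrite addrC.
have sG : scalar_bergman sigma (fun w => F w i + c * k z w).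
  have := bergman_coord i bG.
  by rewrite (_ : (fun w => F w i + c * k z w) = fun w => F w i + c * kv z i w i)//;
    apply/funext => w; rewrite kvE eqxx.
have sF := bergman_coord i bF.
rewrite -!sqint_fin// /energy -!ge0_integralD//; first last.
all: try (by move=> w _; rewrite ?l2sqnorm_ge0// lee_fin sqr_ge0).
all: try (by apply/measurable_EFinP/measurable_funX/cmeasurable_normc/scalar_cmeasurable).
- by apply: measurable_l2sqnorm => j; exact: (bergman_cmeasurable j bG).
- by apply: measurable_l2sqnorm => j; exact: (bergman_cmeasurable j bF).
apply: eq_integral => w _; rewrite /l2sqnorm.
rewrite (nneseriesD1 (n := i))//; last by move=> *; rewrite lee_fin sqr_ge0.
rewrite [in RHS](nneseriesD1 (n := i))//; last by move=> *; rewrite lee_fin sqr_ge0.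
rewrite kvE eqxx addeAC [RHS]addeC addeA; congr (_ + _)%E.
by apply: eq_eseriesr => j /= /negbTE ji; rewrite kvE ji mulr0 addr0.
Qed.

Lemma sqr_defect_ge0 (x y u v w : R) : 0 <= x -> 0 <= y -> x <= y ->
  y ^+ 2 + u = x ^+ 2 + (u + v + w) -> 0 <= v + w.
Proof.
move=> x0 y0 xy e; have : x ^+ 2 <= y ^+ 2 by rewrite ler_pXn2r ?nnegrE.
lra.
Qed.

(** Let b = <g, k_z e_i>.  Minimality along the line through g in the direction
    of -b k_z e_i gives 0 <= -2 x |b|^2 + x^2 |b|^2 ||k_z||^2 for small x > 0,
    hence b = 0, and b is a multiple of the value of g_i at z. *)
Lemma residue_zero g : bergman sigma g ->
  (forall f, kernel_span B f -> bergman_norm sigma g <= bergman_norm sigma (g + f)) ->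
  g = 0.
Proof.
move=> bg H; apply/funext => z; apply/funext => i.
rewrite (reproducing_dot z i bg) dot_kvr; set b := complex_integral _ _.
suff -> : b = 0 by rewrite mulr0.
have sg := bergman_coord i bg; have sk := normalized_kernel_bergman z.
have ineq c : 0 <= 2 * complex.Re (c^* * b) + normc c ^+ 2 * sqint (k z).
  have spanf : kernel_span B (fun w j => c * kv z i w j).
    rewrite (_ : (fun w j => _) = (fun w j => c * kv z i w j + (fun _ _ => 0) w j)).
      apply: kernel_span_lin; last exact: kernel_span0.
      exact/kv_span/finite_vector_l2basis.
    by apply/funext => w; apply/funext => j; rewrite addr0.
  have bf := kernel_span_bergman spanf.
  have bgf := bergman_add bg bf.
  have e := energy_add_kv z i c bg.
  rewrite -[X in energy _ X]/(g + (fun w j => c * kv z i w j)) in e.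
  rewrite sqint_add// -/b in e.
  have fin (x y u v : R) (X Y : \bar R) :
      x%:E = X -> y%:E = Y -> (X + u%:E = Y + v%:E)%E -> x + u = y + v.
    by move=> <- <-; rewrite -!EFinD => -[].
  have {}e := fin _ _ _ _ _ _ (bergman_norm_sqr bgf) (bergman_norm_sqr bg) e.
  exact: (sqr_defect_ge0 (sqrtr_ge0 _) (sqrtr_ge0 _) (H _ spanf) e).
have k0 : 0 <= sqint (k z) by apply: Rintegral_ge0 => w _; exact: sqr_ge0.
have s0 : 0 < sqint (k z) + 1 by rewrite ltr_wpDl.
(* The step 1 / (||k_z||^2 + 1) is small enough for the linear term to win. *)
have := ineq (- ((sqint (k z) + 1)^-1%:C * b)).
rewrite (_ : complex.Re _ = - ((sqint (k z) + 1)^-1 * normc b ^+ 2)); last first.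
  by rewrite sqr_normc_ReIm; case: (b) => x y; simpc => /=; ring.
rewrite normcN Normc.normcM normc_real exprMn real_normK ?num_real//.
have [b0 _|b0] := eqVneq (normc b) 0; first exact: Normc.eq0_normc b0.
have b2 : 0 < normc b ^+ 2 by rewrite exprn_gt0// lt_neqAle eq_sym b0 normc_ge0.
move=> h; exfalso; move: h.
have : 0 < (sqint (k z) + 1)^-1 by rewrite invr_gt0.
have : (sqint (k z) + 1)^-1 * (sqint (k z) + 1) = 1 by rewrite mulVf// gt_eqF.
move: (sqint (k z)) k0 s0 (_^-1) (normc b ^+ 2) b2 => s k0 s0 t x x0 h t0.
have tx0 : 0 < t * x by exact: mulr_gt0.
have -> : t ^+ 2 * x * s = t * x * (t * s) by ring.
have -> : t * s = 1 - t by lra.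
have : 0 < t * x * t by exact: mulr_gt0.
lra.
Qed.

End density.

(** * Boundedness on the span *)

Section span_bound.
Context {R : realType} {n : nat} (B : bergman_space R n).
Local Notation sigma := (Defs.sigma B).
Local Notation K := (Defs.K B).
Local Notation phi := (Defs.phi B).
Local Notation k := (normalized_kernel sigma K).
Local Notation kv z i := (kernel_vector z (l2basis i) : pt B -> nat -> R[i]).
Implicit Types F G : pt B -> nat -> R[i].

Lemma Lnorm_sup_bound (p : R) (f : nat -> pt B -> pt B -> \bar R) : 0 < p ->
  (forall i z u, 0 <= f i z u)%E ->
  (ereal_sup (range (fun i => ereal_sup (range (fun z
    => ('N[sigma]_p%:E[f i z])%E)))) < +oo)%E ->
  exists M : R, forall i z, (\int[sigma]_u (f i z u `^ p) <= M%:E)%E.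
Proof.
move=> p0 f0; set s := ereal_sup _ => soo.
have Ns i z : ('N[sigma]_p%:E[f i z] <= s)%E.
  apply: (@le_trans _ _ (ereal_sup (range (fun z => ('N[sigma]_p%:E[f i z])%E)))).
    by apply: ereal_sup_ubound; exists z.
  by apply: ereal_sup_ubound; exists i.
have s0 : (0 <= s)%E by apply: le_trans (Ns 0%N (origin B)); exact: Lnorm_ge0.
exists (fine s `^ p) => i z.
have -> : (\int[sigma]_u (f i z u `^ p) = 'N[sigma]_p%:E[f i z] `^ p)%E.
  rewrite poweR_Lnorm ?gt_eqF//; apply: eq_integral => u _.
  by rewrite gee0_abs.
rewrite -poweR_EFin fineK ?ge0_fin_numE//.
by apply: gt0_ler_poweR => //; rewrite ?ltW// ?in_itv/= ?Lnorm_ge0 ?leey ?s0.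
Qed.

Lemma cintegrable_bergman F G j : bergman sigma F -> bergman sigma G ->
  cintegrable sigma (fun w => F w j * (G w j)^*).
Proof.
move=> bF bG; apply: cintegrable_mul.
- exact: bergman_cmeasurable bF.
- by apply: cmeasurableJ; exact: bergman_cmeasurable bG.
- by have [] := bergman_coord j bF.
- by under eq_integral do rewrite normcJ; have [] := bergman_coord j bG.
Qed.

Lemma continuous_normc_coord G i (c : R) : bergman sigma G ->
  continuous (fun z => c * normc (G z i)).
Proof.
move=> [_ /(_ i)/analytic_continuous cG _] z.
have cn : normc (G y i) @[y --> z] --> normc (G z i).
  apply/(@cvgrPdist_lt _ _ _ _ (nbhs_filter z)) => e e0.
  have h : \forall y \near z, normc (G z i - G y i) < e.
    exact: (cG z _ (near_normc (G z i) e0)).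
  apply: (@filterS _ _ (nbhs_filter z)) h => y; apply: le_lt_trans.
  exact: ler_dist_normc.
exact: (@cvgM _ _ (nbhs z) (nbhs_filter z) (cst c) (fun y => normc (G y i)) _ _
  (cvg_cst c) cn).
Qed.

Section operator.
Variables (T Tstar : (pt B -> nat -> R[i]) -> (pt B -> nat -> R[i])).
Hypothesis T_linear : linear_operator (kernel_span B) (bergman sigma) T.
Hypothesis Tstar_linear : linear_operator (kernel_span B) (bergman sigma) Tstar.
Hypothesis T_adjoint : forall (z w : pt B) (e h : nat -> R[i]),
       finite_vector e -> finite_vector h ->
       bergman_dot sigma (T (kernel_vector z e)) (kernel_vector w h) =
       bergman_dot sigma (kernel_vector z e) (Tstar (kernel_vector w h)).

Let T_kv z i : bergman sigma (T (kv z i)).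
Proof. exact/T_linear.1/kv_span/finite_vector_l2basis. Qed.

Let Tstar_kv z i : bergman sigma (Tstar (kv z i)).
Proof. exact/Tstar_linear.1/kv_span/finite_vector_l2basis. Qed.

(** Both sides are ||K_z|| ||K_w|| |<T (k_w e_j), k_z e_i>|. *)
Lemma kernel_symmetry z w i j :
  norm B z * normc (Tstar (kv z i) w j) = norm B w * normc (T (kv w j) z i).
Proof.
rewrite (reproducing_dot w j (Tstar_kv z i)) (reproducing_dot z i (T_kv w j)).
rewrite T_adjoint ?dot_kvC//; try exact: finite_vector_l2basis.
rewrite !Normc.normcM normcJ !normc_real !ger0_norm ?K_norm_ge0//.
by rewrite mulrCA.
Qed.

Lemma T_zero : T (fun _ _ => 0) = fun _ _ => 0.
Proof.
pose O : pt B -> nat -> R[i] := fun _ _ => 0.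
have h := T_linear.2 (-1) O O (kernel_span0 B) (kernel_span0 B).
have e : (fun w j => -1 * O w j + O w j) = O.
  by apply/funext => w; apply/funext => j; rewrite mulN1r addNr.
rewrite e in h; rewrite -/O h.
by apply/funext => w; apply/funext => j; rewrite mulN1r addNr.
Qed.

(** For k_x e_l this is the adjoint relation, and both sides are linear in F.
    The sum may be taken up to any large index because the coordinates of F
    vanish from some index on; this freedom lets two such sums be added. *)
Lemma T_integral_formula F : kernel_span B F ->
  exists J, forall J', (J <= J')%N -> forall z i,
    T F z i = \sum_(j < J') complex_integral sigma
      (fun w => F w j * ((norm B z)%:C * Tstar (kv z i) w j)^*).
Proof.
have bZ z i := bergmanZ (norm B z)%:C (Tstar_kv z i).
pose P G := exists J, forall J', (J <= J')%N -> forall z i,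
  T G z i = \sum_(j < J') complex_integral sigma
    (fun w => G w j * ((norm B z)%:C * Tstar (kv z i) w j)^*).
apply: (@kernel_span_ind _ _ B P) => [|x l|a F1 F2 S1 S2 [J1 H1] [J2 H2]].
- exists 0%N => J' _ z i; rewrite T_zero big1// => j _.
  by under [X in complex_integral _ X]eq_fun do rewrite mul0r; exact: complex_integral0.
- exists l.+1 => J' lJ z i.
  rewrite (bigD1 (Ordinal lJ))//= big1 ?addr0; last first.
    move=> j; rewrite -val_eqE /= => /negbTE jl.
    under [X in complex_integral _ X]eq_fun do rewrite kvE jl mul0r.
    exact: complex_integral0.
  rewrite (reproducing_dot z i (T_kv x l)) T_adjoint; try exact: finite_vector_l2basis.
  rewrite dot_kvl -complex_integralZ.
    congr complex_integral; apply/funext => w.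
    rewrite kvE eqxx mulrCA; congr (_ * _).
    by rewrite conjc_mull.
  have := cintegrable_bergman l (kv_bergman x l) (Tstar_kv z i).
  by rewrite (_ : (fun w => kv x l w l * _) = (fun w => k x w * (Tstar (kv z i) w l)^*))//;
    apply/funext => w; rewrite kvE eqxx.
- exists (maxn J1 J2) => J'; rewrite geq_max => /andP[h1 h2] z i.
  rewrite T_linear.2// (H1 _ h1) (H2 _ h2) mulr_sumr -big_split.
  apply: eq_bigr => j _ /=.
  have bS1 := kernel_span_bergman S1; have bS2 := kernel_span_bergman S2.
  have I1 := cintegrable_bergman j bS1 (bZ z i).
  have I2 := cintegrable_bergman j bS2 (bZ z i).
  rewrite -complex_integralZ// -complex_integralD//; last exact: cintegrableZ.
  by congr complex_integral; apply/funext => w; rewrite mulrDl mulrA.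
Qed.

Definition schur_kernel i j z w : R := 2 * (norm B z * normc (Tstar (kv z i) w j)).

Lemma T_schur_le F z i : kernel_span B F ->
  ((normc (T F z i))%:E <=
   \sum_(j <oo) \int[sigma]_w (schur_kernel i j z w * normc (F w j))%:E)%E.
Proof.
move=> SF; have bF := kernel_span_bergman SF.
have [J /(_ J (leqnn J))/(_ z i) ->] := T_integral_formula SF.
have bZ := bergmanZ (norm B z)%:C (Tstar_kv z i).
have I0 j : (0 <= \int[sigma]_w (schur_kernel i j z w * normc (F w j))%:E)%E.
  by apply: integral_ge0 => w _; rewrite lee_fin !mulr_ge0 ?normc_ge0 ?K_norm_ge0.
apply: (@le_trans _ _ (\sum_(0
  <= j < J) \int[sigma]_w (schur_kernel i j z w * normc (F w j))%:E)%E);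
  last exact: nneseries_lim_ge.
rewrite big_mkord.
apply: (@le_trans _ _ (\sum_(j < J) (normc (complex_integral sigma
      (fun w => F w j * ((norm B z)%:C * Tstar (kv z i) w j)^*)))%:E)%E).
  rewrite sumEFin lee_fin.
  elim/big_ind2 : _ => [||//]; first by rewrite normc_zero.
  by move=> x1 x2 y1 y2 h1 h2; apply: le_trans (le_normcD _ _) _; exact: lerD.
apply: lee_sum => j _.
have Ij := cintegrable_bergman j bF bZ.
apply: le_trans (complex_integral_norm_le Ij) _.
rewrite -ge0_integralZl//.
- rewrite le_eqVlt; apply/orP; left; apply/eqP; apply: eq_integral => w _.
  rewrite -EFinM; congr EFin.
  rewrite Normc.normcM normcJ Normc.normcM normc_real ger0_norm ?K_norm_ge0//.
  by rewrite /schur_kernel -mulrA; congr (_ * _); rewrite mulrC.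
- exact/measurable_EFinP/cmeasurable_normc/Ij.1.
- by move=> w _; rewrite lee_fin normc_ge0.
Qed.

Lemma integral_l1norm_series (X : pt B -> nat -> R[i]) (c : R) (h : pt B -> R) :
  (forall j, cmeasurable (fun w => X w j)) -> 0 <= c ->
  measurable_fun setT h -> (forall w, 0 <= h w) ->
  (\sum_(j <oo) \int[sigma]_w (2 * (c * normc (X w j)) * h w)%:E =
   2%:E * (c%:E * \int[sigma]_w (l1norm (X w) * (h w)%:E)))%E.
Proof.
move=> mX c0 mh h0.
have mn j : measurable_fun setT (fun w => normc (X w j)) by exact: cmeasurable_normc.
have m1 j : measurable_fun setT (fun w => (normc (X w j) * h w)%:E).
  by apply/measurable_EFinP; exact: measurable_funM.
have p1 j w : (0 <= (normc (X w j) * h w)%:E)%E by rewrite lee_fin mulr_ge0 ?normc_ge0.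
have -> : (\int[sigma]_w (l1norm (X w) * (h w)%:E) =
    \sum_(j <oo) \int[sigma]_w (normc (X w j) * h w)%:E)%E.
  rewrite -integral_nneseries//; apply: eq_integral => w _.
  rewrite muleC /l1norm -nneseriesZl; last by move=> j _; rewrite lee_fin normc_ge0.
  by apply: eq_eseriesr => j _; rewrite -EFinM mulrC.
rewrite muleA -nneseriesZl; last by move=> j _; exact: integral_ge0.
apply: eq_eseriesr => j _; rewrite -ge0_integralZl//.
- by apply: eq_integral => w _; rewrite -EFinM !mulrA.
- by rewrite lee_fin mulr_ge0.
Qed.

Lemma energy_series F : (forall j, cmeasurable (fun w => F w j)) ->
  (energy sigma F = \sum_(j <oo) \int[sigma]_w (normc (F w j) ^+ 2)%:E)%E.
Proof.
move=> mF; rewrite /energy -integral_nneseries//.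
- by move=> j; exact/measurable_EFinP/measurable_funX/cmeasurable_normc/mF.
- by move=> j w _; rewrite lee_fin sqr_ge0.
Qed.

(** By [kernel_symmetry], the column sums of the Schur kernel are row sums for
    T, so both conditions of the Schur test come from [weighted_l1_bound]. *)
Lemma T_bounded_on_span (p : R) : (4 - kappa B) / (2 - kappa B) < p ->
  (exists M : R, forall i z, (\int[sigma]_u
     ((l1norm (Tstar (kv z i) (phi z u)) * (normc (k z u))%:E) `^ p) <= M%:E)%E) ->
  (exists M : R, forall i z, (\int[sigma]_u
     ((l1norm (T (kv z i) (phi z u)) * (normc (k z u))%:E) `^ p) <= M%:E)%E) ->
  exists C : R, forall F, kernel_span B F ->
    bergman_norm sigma (T F) <= C * bergman_norm sigma F.
Proof.
move=> hp [M1 hM1] [M2 hM2].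
have [a ha] := weighted_l1_bound hp.
have [C1 C10 hC1] := ha M1; have [C2 C20 hC2] := ha M2.
pose C := 2 * (C1 + C2) + 1.
have C0 : 0 < C by rewrite ltr_wpDl// mulr_ge0// addr_ge0.
exists C => F SF.
have bF := kernel_span_bergman SF; have bTF := T_linear.1 _ SF.
pose h z := norm B z `^ a.
have h0 z : 0 < h z by rewrite powR_gt0// K_norm_gt0.
have h0' z : 0 <= h z by exact: ltW.
have mh : measurable_fun setT h.
  have mN : measurable_fun setT (fun z : pt B => norm B z) by exact: K_norm_measurable.
  exact: (measurableT_comp (measurable_powR a) mN).
have mG G j : bergman sigma G -> cmeasurable (fun w => G w j) by exact: bergman_cmeasurable.
have rowcol (X : pt B -> nat -> R[i]) z (c : R) : bergman sigma X -> 0 <= c ->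
    ((norm B z)%:E * \int[sigma]_w (l1norm (X w) * (h w)%:E) <= (c * h z)%:E)%E ->
    2 * c <= C ->
    (\sum_(j <oo) \int[sigma]_w (2 * (norm B z * normc (X w j)) * h w)%:E
      <= (C * h z)%:E)%E.
  move=> bX c0 hX cC; rewrite integral_l1norm_series ?K_norm_ge0//; last by move=> j;
    exact: mG.
  apply: (@le_trans _ _ (2%:E * (c * h z)%:E)%E); first by apply: lee_wpmul2l.
  by rewrite -EFinM lee_fin mulrA ler_pM2r.
have rowA i z : (\sum_(j <oo) \int[sigma]_w (schur_kernel i j z w * h w)%:E
  <= (C * h z)%:E)%E.
  apply: (rowcol _ _ C1) => //; last by rewrite /C; lra.
  by apply: hC1 => // j; exact: mG.
have colA j w : (\sum_(i <oo) \int[sigma]_z (schur_kernel i j z w * h z)%:E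
  <= (C * h w)%:E)%E.
  under eq_eseriesr do under eq_integral do rewrite /schur_kernel kernel_symmetry.
  apply: (rowcol _ _ C2) => //; last by rewrite /C; lra.
  by apply: hC2 => // i; exact: mG.
have A0 i j z w : 0 <= schur_kernel i j z w.
  by rewrite !mulr_ge0 ?normc_ge0 ?K_norm_ge0.
have mA i j : measurable_fun setT (fun zw : pt B * pt B => schur_kernel i j zw.1 zw.2).
  apply: (@measurable_separately_continuous _ _ _ (schur_kernel i j)).
    move=> z; apply: measurable_funM => //; apply: measurable_funM => //.
    exact/cmeasurable_normc/mG.
  move=> w; rewrite (_ : (schur_kernel i j)^~ w = fun z
    => (2 * norm B w) * normc (T (kv w j) z i)).
    exact: continuous_normc_coord.
  by apply/funext => z; rewrite /schur_kernel kernel_symmetry mulrA.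
have F0 w j : 0 <= normc (F w j) by exact: normc_ge0.
have g0 z i : 0 <= normc (T F z i) by exact: normc_ge0.
have mF j : measurable_fun setT (fun w => normc (F w j)).
  exact/cmeasurable_normc/mG.
have mg i : measurable_fun setT (fun z => normc (T F z i)).
  exact/cmeasurable_normc/mG.
have gF i z := T_schur_le z i SF.
have := schur_test A0 mA h0 mh C0 rowA colA F0 g0 mF mg gF.
rewrite -!energy_series; try (by move=> j; exact: mG).
rewrite -!bergman_norm_sqr// -EFinM lee_fin -exprMn ler_pXn2r// nnegrE ?sqrtr_ge0//.
by rewrite mulr_ge0 ?sqrtr_ge0// ltW.
Qed.

End operator.
End span_bound.

(** * The theorem *)

Section bergman_norm_lemmas.
Context {R : realType} {n : nat} (B : bergman_space R n).
Local Notation sigma := (Defs.sigma B).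
Implicit Types F G : pt B -> nat -> R[i].

Lemma bergman_norm_ge0 F : 0 <= bergman_norm sigma F.
Proof. exact: sqrtr_ge0. Qed.

Lemma bergman_normZ a F : bergman sigma F ->
  bergman_norm sigma (fun w j => a * F w j) = normc a * bergman_norm sigma F.
Proof.
move=> bF; apply/eqP; rewrite -(eqrXn2 (n := 2))//; last 2 first.
- exact: bergman_norm_ge0.
- by rewrite mulr_ge0 ?normc_ge0 ?bergman_norm_ge0.
apply/eqP; rewrite exprMn.
have e := energyZ sigma a (fun k => bergman_cmeasurable k bF).
have fin (x y c : R) (X Y : \bar R) :
    x%:E = X -> y%:E = Y -> (X = c%:E * Y)%E -> x = c * y.
  by move=> <- <-; rewrite -EFinM => -[].
exact: (fin _ _ _ _ _ (bergman_norm_sqr (bergmanZ a bF)) (bergman_norm_sqr bF) e).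
Qed.

Lemma bergman_norm_parallelogram (t : R) F G : 0 < t -> bergman sigma F
  -> bergman sigma G ->
  bergman_norm sigma (F + G) ^+ 2 +
    t^-1 * bergman_norm sigma (fun w j => t%:C * F w j - G w j) ^+ 2 =
  (1 + t) * bergman_norm sigma F ^+ 2 + (1 + t^-1) * bergman_norm sigma G ^+ 2.
Proof.
move=> t0 bF bG.
have bS : bergman sigma (fun w j => t%:C * F w j - G w j).
  have := bergman_add (bergmanZ t%:C bF) (bergmanZ (-1) bG).
  rewrite (_ : _ + _ = fun w j => t%:C * F w j - G w j)//.
  by apply/funext => w; apply/funext => j; rewrite !fctE mulN1r.
have e := energy_parallelogram sigma t0 (fun k => bergman_cmeasurable k bF)
  (fun k => bergman_cmeasurable k bG).
have fin (x y u v b c d : R) (X Y U W : \bar R) :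
    x%:E = X -> y%:E = Y -> u%:E = U -> v%:E = W ->
    (X + b%:E * Y = c%:E * U + d%:E * W)%E -> x + b * y = c * u + d * v.
  by move=> <- <- <- <-; rewrite -!EFinM -!EFinD => -[].
exact: (fin _ _ _ _ _ _ _ _ _ _ _ (bergman_norm_sqr (bergman_add bF bG))
  (bergman_norm_sqr bS) (bergman_norm_sqr bF) (bergman_norm_sqr bG) e).
Qed.

End bergman_norm_lemmas.

Local Close Scope complex_scope.
Unset Implicit Arguments.

Theorem theorem3p1 (R : realType) (n : nat) (B : bergman_space R n)
    (T Tstar : (pt B -> nat -> R[i]) -> (pt B -> nat -> R[i])) (p : R)
    (T_linear : linear_operator (kernel_span B) (bergman (sigma B)) T)
    (Tstar_linear : linear_operator (kernel_span B) (bergman (sigma B)) Tstar)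
    (T_adjoint : forall (z w : pt B) (e h : nat -> R[i]),
       finite_vector e -> finite_vector h ->
       bergman_dot (sigma B) (T (kernel_vector z e)) (kernel_vector w h) =
       bergman_dot (sigma B) (kernel_vector z e) (Tstar (kernel_vector w h)))
    (p_large : (4 - kappa B) / (2 - kappa B) < p)
    (Tstar_sup :
       (ereal_sup (range (fun i : nat =>
          ereal_sup (range (fun z : pt B =>
            ('N[sigma B]_p%:E[(fun u => \sum_(k <oo)
               (Normc.normc (l2dot
                  (translation z (Tstar (kernel_vector z (l2basis i))) u)
                  (l2basis k)))%:E)])%E)))) < +oo)%E)
    (T_sup :
       (ereal_sup (range (fun k : nat =>
          ereal_sup (range (fun z : pt B =>
            ('N[sigma B]_p%:E[(fun u => \sum_(i <oo)
               (Normc.normc (l2dot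
                  (translation z (T (kernel_vector z (l2basis k))) u)
                  (l2basis i)))%:E)])%E)))) < +oo)%E) :
  exists S : (pt B -> nat -> R[i]) -> (pt B -> nat -> R[i]),
    bounded_operator S /\ (forall F, kernel_span B F -> S F = T F).
Proof.
have [p2 _ _ _] := schur_exponent (kappa_bounds B) p_large.
have p0 : 0 < p by apply: lt_trans p2.
have sup_bound (X : (pt B -> nat -> R[i]) -> (pt B -> nat -> R[i])) :
    (ereal_sup (range (fun i : nat => ereal_sup (range (fun z : pt B =>
      ('N[sigma B]_p%:E[(fun u => \sum_(k <oo) (Normc.normc (l2dot
          (translation z (X (kernel_vector z (l2basis i))) u)
          (l2basis k)))%:E)])%E)))) < +oo)%E ->
    exists M : R, forall i z, (\int[sigma B]_u
      ((l1norm (X (kernel_vector z (l2basis i)) (phi B z u)) *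
        (Normc.normc (normalized_kernel (sigma B) (K B) z u))%:E) `^ p) <= M%:E)%E.
  move=> h.
  have f0 i z u : (0 <= \sum_(k <oo) (Normc.normc (l2dot
      (translation z (X (kernel_vector z (l2basis i))) u) (l2basis k)))%:E)%E.
    by apply: nneseries_ge0 => k _ _; rewrite lee_fin normc_ge0.
  have [M hM] := Lnorm_sup_bound p0 f0 h; exists M => i z.
  by under eq_integral do rewrite -l1norm_translation; exact: hM.
have [C hC] := T_bounded_on_span T_linear Tstar_linear T_adjoint p_large
  (sup_bound _ Tstar_sup) (sup_bound _ T_sup).
(* The regular module R[i]^o gives the functions their pointwise scaling. *)
pose V : lmodType R[i] := (pt B -> nat -> R[i]^o).
pose N : V -> R := fun F => bergman_norm (sigma B) F.
pose A : set V := bergman (sigma B).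
pose W : set V := kernel_span B.
have A_lin a (x y : V) : A x -> A y -> A (a *: x + y).
  by move=> Ax Ay; exact: (bergman_lin a Ax Ay).
have W_lin a (x y : V) : W x -> W y -> W (a *: x + y).
  by move=> Wx Wy; exact: (kernel_span_lin a Wx Wy).
have W0 : W 0 by exact: kernel_span0.
have WA : W `<=` A by move=> F; exact: kernel_span_bergman.
have N_ge0 (x : V) : 0 <= N x by exact: bergman_norm_ge0.
have NZ a (x : V) : A x -> N (a *: x) = Normc.normc a * N x.
  by move=> Ax; exact: (bergman_normZ a Ax).
have N_par (t : R) (x y : V) : 0 < t -> A x -> A y ->
  N (x + y) ^+ 2 + t^-1 * N (t%:C%C *: x - y) ^+ 2 =
  (1 + t) * N x ^+ 2 + (1 + t^-1) * N y ^+ 2.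
  by move=> t0 Ax Ay; exact: (bergman_norm_parallelogram t0 Ax Ay).
have A_complete : complete_for A N by exact: (bergman_complete (b := B)).
have W_dense (x : V) e : A x -> 0 < e -> exists2 f, W f & N (x - f) < e.
  move=> Ax e0.
  have [g Ag [approx gmin]] := orthogonal_residue A_lin W_lin W0 WA N_ge0 NZ N_par
    A_complete Ax.
  have g0 : g = 0 by exact: (residue_zero Ag gmin).
  by have [f Wf hf] := approx _ e0; exists f => //; rewrite g0 subr0 in hf.
have N_def (x : V) : A x -> N x = 0 -> x = 0.
  move=> Ax Nx0.
  have xmin (f : V) : W f -> N x <= N (x + f) by rewrite Nx0.
  exact: (residue_zero Ax xmin).
have [TA T_lin] := T_linear.
have [S [SA S_lin S_bound ST]] := bounded_extension A_lin W_lin W0 WA N_ge0 NZ N_par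
  A_complete (T := T : V -> V) TA T_lin hC W_dense N_def.
exists S; split => //; split; first by split.
by exists (`|C| + 1).
Qed.
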